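(* Let $\mathcal{G}(\mathcal{A},J)$ be an $N$-player game satisfying assumptions A1 (smoothness) and A2 (player-wise convexity), with pseudogradient $F$ and game Hessian $H$, and let $a^*$ be a stable Nash equilibrium of $\mathcal{G}(\mathcal{A},J)$. Then there exists $\delta>0$ such that for every $a^0\in\mathcal{A}\cap\mathbf{B}(a^*,\delta)$ the Josephy-Newton update, in which, given $a^k$, the next iterate $a^{k+1}$ is a solution $a$ of the generalized equation $$F(a^k)+H(a^k)(a-a^k)+\mathcal{N}_{\mathcal{A}}(a)\ni 0,$$ generates a well-defined sequence $\{a^k\}$ in $\mathbf{B}(a^*,\delta)$ (that is, there is a sequence starting at $a^0$, contained in $\mathbf{B}(a^*,\delta)$, and satisfying the update for all $k\ge0$), and every such sequence converges $Q$-quadratically to $a^*$.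
   Context: Game. Each player $i\in\{1,\dots,N\}$ has cost $J_i:\mathbb{R}^n\to\mathbb{R}$ and chooses $a_i\in\mathcal{A}_i\subseteq\mathbb{R}^{n_i}$, $n=\sum_i n_i$, $\mathcal{A}=\prod_{i=1}^N\mathcal{A}_i$; write $a=(a_1,\dots,a_N)=(a_i,a_{-i})$. A point $a^*\in\mathcal{A}$ is a Nash equilibrium (NE) if for every $i$, $a_i^*\in\arg\min_{a_i\in\mathcal{A}_i}J_i(a_i,a^*_{-i})$. $\mathrm{NESet}(\mathcal{G})$ denotes the set of all NEs of $\mathcal{G}$. A1 (smoothness): for every $i$, $J_i$ is twice continuously differentiable and its second-order derivatives are Lipschitz continuous. A2 (player-wise convexity): for every $i$ and every $a_{-i}$, $J_i(\cdot,a_{-i})$ is convex, and $\mathcal{A}_i$ is compact and convex. The pseudogradient is $F(a)=(\nabla_{a_i}J_i(a))_{i=1}^N$, $F:\mathbb{R}^n\to\mathbb{R}^n$. The game Hessian $H(a)\in\mathbb{R}^{n\times n}$ is the block matrix with $(i,j)$ block $\nabla^2_{a_ia_j}J_i(a)$. The normal cone is $\mathcal{N}_{\mathcal{A}}(a)=\{b\in\mathbb{R}^n: b^T(a'-a)\le 0\ \forall a'\in\mathcal{A}\}$ for $a\in\mathcal{A}$ (and empty for $a\notin\mathcal{A}$). $\mathbf{B}(a^*,\delta)$ is the open Euclidean ball with center $a^*$ and radius $\delta$. Game neighborhood: for $\mathcal{S}\subset\mathcal{A}$ and $\epsilon>0$, a game $\tilde{\mathcal{G}}(\mathcal{A},\tilde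 J)$ (same strategy sets) belongs to $\mathbf{B}(\mathcal{G};\epsilon,\mathcal{S})$ if it satisfies A1 and A2 and its pseudogradient $\tilde F$ satisfies $\sup_{a\in\mathcal{S}}\|F(a)-\tilde F(a)\|<\epsilon$ (Euclidean norm). Stable NE: an NE $a^*$ of $\mathcal{G}(\mathcal{A},J)$ is stable if it is isolated (i.e. $\mathrm{NESet}(\mathcal{G})\cap\Omega=\{a^*\}$ for some neighborhood $\Omega$ of $a^*$) and, for every open neighborhood $\Omega$ of $a^*$ with $\mathrm{NESet}(\mathcal{G})\cap\mathrm{cl}\,\Omega=\{a^*\}$ (where $\mathrm{cl}\,\Omega$ is the closure of $\Omega$), there exist positive scalars $c$ and $\epsilon$ such that for every $\tilde{\mathcal{G}}\in\mathbf{B}(\mathcal{G};\epsilon,\mathcal{A}\cap\mathrm{cl}\,\Omega)$: (i) $\mathrm{NESet}(\tilde{\mathcal{G}})\cap\mathrm{cl}\,\Omega\neq\emptyset$; and (ii) every $\tilde a\in\mathrm{NESet}(\tilde{\mathcal{G}})\cap\mathrm{cl}\,\Omega$ satisfies $\|\tilde a-a^*\|\le c\,\|F(\tilde a)-\tilde F(\tilde a)\|$. $Q$-quadratic convergence of $\{a^k\}$ to $a^*$ means $a^k\to a^*$ and there is a constant $C<\infty$ with $\|a^{k+1}-a^*\|\le C\|a^k-a^*\|^2$ for all sufficiently large $k$. *)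

(* Defs.v *)
(* Games with N players: player i acts in R^(n_ i) and the joint action is the
   column vector of size \sum_i n_ i whose i-th block is [submxcol a i].
   Topology and Lipschitz continuity are the library's, i.e. those of the sup
   norm on column vectors, which is equivalent to the Euclidean one; balls,
   error bounds and convergence rates use the Euclidean norm [enorm]. *)
From HB Require Import structures.
From mathcomp Require Export all_boot all_order all_algebra.
From mathcomp Require Export all_classical all_reals all_analysis.

Set Implicit Arguments.
Unset Strict Implicit.
Unset Printing Implicit Defensive.

Import Order.TTheory GRing.Theory Num.Theory numFieldNormedType.Exports.

Local Open Scope classical_set_scope.
Local Open Scope ring_scope.

Section calculus.
Context {R : realType} {n : nat}.
Implicit Types (f : 'cV[R]_n -> R) (a x : 'cV[R]_n).

Definition enorm x : R := Num.sqrt (\sum_(p < n) (x p 0) ^+ 2).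

Definition eball a (r : R) : set 'cV[R]_n := [set x | enorm (x - a) < r].

Definition grad f a : 'cV[R]_n := \col_p 'D_(delta_mx p 0) f a.

(* entry (p, q) is the q-th partial derivative of the p-th partial derivative *)
Definition hess f a : 'M[R]_n :=
  \matrix_(p, q) 'D_(delta_mx q 0) (fun x => grad f x p 0) a.

Definition C1 f := (forall a, differentiable f a) /\ continuous (grad f).

Definition C2 f := C1 f /\ forall p, C1 (fun a => grad f a p 0).

Definition normal_cone (A : set 'cV[R]_n) a : set 'cV[R]_n :=
  [set b | A a /\ forall a', A a' -> (b^T *m (a' - a)) 0 0 <= 0].

Definition Qquadratic_cvg (u : nat -> 'cV[R]_n) a :=
  (u @ \oo --> a) /\
  exists C : R, \forall k \near \oo, enorm (u k.+1 - a) <= C * enorm (u k - a) ^+ 2.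

End calculus.

Section game.
Context {R : realType} {N : nat} {n_ : 'I_N -> nat}.

Local Notation profile := 'cV[R]_(\sum_(i < N) n_ i).
Implicit Types (A : forall i, set 'cV[R]_(n_ i)) (J : 'I_N -> profile -> R).
Implicit Types (a x : profile).

Definition strategies A : set profile := [set a | forall i, A i (submxcol a i)].

(* the profile (y, a_{-i}) *)
Definition deviate a i (y : 'cV[R]_(n_ i)) : profile :=
  \mxcol_j eqtype.dfwith (submxcol a) y j.

Definition NESet A J : set profile :=
  [set a | strategies A a /\
           forall i y, A i y -> J i a <= J i (deviate a y)].

Definition smooth_game J := forall i,
  C2 (J i) /\ forall p q, lipschitz (fun a => hess (J i) a p q).

(* the costs are convex in the player's own action over all of R^(n_ i), for
   arbitrary (not necessarily feasible) actions of the other players *)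
Definition convex_game A J := forall i,
  (forall a, convex_function setT (fun y : 'cV[R]_(n_ i) => J i (deviate a y))) /\
  compact (A i) /\ convex_set (A i).

Definition pseudogradient J a : profile := \mxcol_i submxcol (grad (J i) a) i.

Definition game_hessian J a : 'M[R]_(\sum_(i < N) n_ i) :=
  \mxblock_(i, j) submxblock (hess (J i) a) i j.

(* The supremum is taken in the extended reals: it is -oo on the empty set and
   +oo on unbounded sets. *)
Definition game_nbhd A J (eps : R) (S : set profile)
    : set ('I_N -> profile -> R) :=
  [set J' | [/\ smooth_game J', convex_game A J' &
    (ereal_sup [set (enorm (pseudogradient J a - pseudogradient J' a))%:E
               | a in S] < eps%:E)%E]].

Definition isolated_NE A J a :=
  exists2 Omega, nbhs a Omega & NESet A J `&` Omega = [set a].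

Definition stable_NE A J a :=
  [/\ NESet A J a,
      isolated_NE A J a &
      forall Omega, open Omega -> Omega a ->
        NESet A J `&` closure Omega = [set a] ->
        exists c eps : R, [/\ 0 < c, 0 < eps &
          forall J', game_nbhd A J eps (strategies A `&` closure Omega) J' ->
            (NESet A J' `&` closure Omega !=set0) /\
            (forall x, (NESet A J' `&` closure Omega) x ->
               enorm (x - a) <=
               c * enorm (pseudogradient J x - pseudogradient J' x))]].

(* x solves  F(y) + H(y) (x - y) + N_A(x) \ni 0 *)
Definition josephy_newton_step A J y x :=
  exists2 b, normal_cone (strategies A) x b &
    pseudogradient J y + game_hessian J y *m (x - y) + b = 0.

Definition josephy_newton_seq A J a0 (u : nat -> profile) :=
  u 0%N = a0 /\ forall k, josephy_newton_step A J (u k) (u k.+1).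

End game.

(* Main.v *)
(* For y near a*, the Josephy-Newton subproblem at y is the variational
   inequality of the map L_y(x) = F(y) + H(y)(x - y).  To use stability, which
   only speaks about games whose pseudogradient is close to F on a fixed
   neighborhood, one needs a player-wise convex game that is close to the
   original one there but has pseudogradient exactly L_y on a small ball of
   radius rho around a*.  Let Q_i be the second order Taylor polynomial of J_i
   at y and put
     J'_i = J_i + chi(S) (Q_i - J_i) + K eta(S),   S(a) = |a - a*|^2 / rho^2,
   where chi = 1 for S <= 2, chi = 0 for S >= 3, and eta is convex, vanishes for
   S <= 1, is linear for S >= 3 and has slope at least 1/2 for S >= 2.
   As Q_i - J_i = O(rho^3) with gradient O(rho^2) where chi is not constant, the
   derivatives of the cutoff spoil the convexity in a_i by at most O(rho), which
   the convex radial term makes up for with K = O(rho^3); its gradient is then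
   only O(rho).  Stability thus yields a Nash equilibrium x of J' with
   |x - a*| < rho, which solves the subproblem, and conversely every solution x
   of the subproblem with |x - a*| < rho is an equilibrium of J', so
     |x - a*| <= c |F(x) - L_y(x)| = O(|x - y|^2),
   that is |x - a*| = O(|y - a*|^2). *)
Require Import Defs.
From mathcomp Require Import ring lra.
Import Order.TTheory GRing.Theory Num.Theory numFieldNormedType.Exports.

Set Implicit Arguments.
Unset Strict Implicit.
Unset Printing Implicit Defensive.

Local Open Scope classical_set_scope.
Local Open Scope ring_scope.

(** * Functions that are Lipschitz on balls, and partial derivatives *)

Section locally_lipschitz.
Context {R : realType} {U : normedModType R}.
Implicit Types f g : U -> R.

(* Lipschitz on every ball: unlike global Lipschitz continuity, this is stable
   under products. *)
Definition llip f := forall r : R, exists L : R, forall x y : U,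
  `|x| <= r -> `|y| <= r -> `|f x - f y| <= L * `|x - y|.

Lemma llip_ge0 f : llip f -> forall r : R, exists2 L : R, 0 <= L &
  forall x y : U, `|x| <= r -> `|y| <= r -> `|f x - f y| <= L * `|x - y|.
Proof.
move=> lf r; have [L fL] := lf r; exists `|L| => // x y xr yr.
by rewrite (le_trans (fL _ _ xr yr))// ler_wpM2r// ler_norm.
Qed.

Lemma llip_bounded f : llip f -> forall r : R, exists2 B : R, 0 <= B &
  forall x : U, `|x| <= r -> `|f x| <= B.
Proof.
move=> lf r; have [L L0 fL] := llip_ge0 lf r.
exists (L * `|r| + `|f 0|) => [|x xr]; first by rewrite addr_ge0// mulr_ge0.
have r0 : 0 <= r by rewrite (le_trans _ xr).
rewrite -(subrK (f 0) (f x)) (le_trans (ler_normD _ _))// lerD2r.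
rewrite (le_trans (fL _ _ xr _)) ?normr0// subr0 ler_wpM2l//.
by rewrite (le_trans xr)// ler_norm.
Qed.

Lemma llip_cst (c : R) : llip (fun=> c).
Proof. by move=> r; exists 0 => x y _ _; rewrite subrr normr0 mul0r. Qed.

Lemma llipD f g : llip f -> llip g -> llip (fun a => f a + g a).
Proof.
move=> lf lg r; have [L fL] := lf r; have [M gM] := lg r.
exists (L + M) => x y xr yr; rewrite opprD addrACA mulrDl.
by rewrite (le_trans (ler_normD _ _))// lerD ?fL ?gM.
Qed.

Lemma llipM f g : llip f -> llip g -> llip (fun a => f a * g a).
Proof.
move=> lf lg r; have [L L0 fL] := llip_ge0 lf r.
have [M M0 gM] := llip_ge0 lg r.
have [B B0 fB] := llip_bounded lf r; have [C C0 gC] := llip_bounded lg r.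
exists (L * C + B * M) => x y xr yr.
rewrite (_ : _ - _ = (f x - f y) * g x + f y * (g x - g y)); last by ring.
rewrite (le_trans (ler_normD _ _))// !normrM mulrDl lerD//.
  by rewrite mulrAC ler_pM ?fL ?gC.
by rewrite -mulrA ler_pM ?fB ?gM.
Qed.

Lemma llip_sum (I : finType) (F : I -> U -> R) :
  (forall i, llip (F i)) -> llip (fun a => \sum_i F i a).
Proof.
move=> lF; have : forall s : seq I, llip (fun a => \sum_(i <- s) F i a).
  elim=> [|i s IH].
    by move=> r; exists 0 => x y _ _; rewrite !big_nil subrr normr0 mul0r.
  rewrite [X in llip X](_ : _ = fun a => F i a + \sum_(j <- s) F j a).
    exact: llipD.
  by apply/funext => a; rewrite big_cons.
exact.
Qed.

Lemma llip_continuous f : llip f -> continuous f.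
Proof.
move=> lf a; have [L L0 fL] := llip_ge0 lf (`|a| + 1).
apply/cvgrPdist_le => e e0; near=> x.
have ax1 : `|a - x| <= 1.
  by near: x; apply: cvgr_dist_le => //; exact: cvg_id.
have axe : `|a - x| <= e / (L + 1).
  near: x; apply: cvgr_dist_le; first exact: cvg_id.
  by rewrite divr_gt0// ltr_wpDl.
rewrite (le_trans (fL _ _ _ _))//.
- by rewrite lerDl.
- rewrite -(subrK a x) (le_trans (ler_normD _ _))// addrC lerD2l.
  by rewrite distrC.
- rewrite (@le_trans _ _ ((L + 1) * `|a - x|)) ?ler_wpM2r ?lerDl//.
  by rewrite mulrC -ler_pdivlMr// ltr_wpDl.
Unshelve. all: by end_near. Qed.

(** On a ball [f] takes its values in a bounded interval [-B, B], so only the Lipschitz constant of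
    [phi] on that interval matters. *)
Lemma llip_comp (phi : R -> R) f : llip f ->
  (forall r : R, exists L : R, forall x y : R,
     `|x| <= r -> `|y| <= r -> `|phi x - phi y| <= L * `|x - y|) ->
  llip (fun a => phi (f a)).
Proof.
move=> lf lphi r; have [L L0 fL] := llip_ge0 lf r.
have [B B0 fB] := llip_bounded lf r; have [M phiM] := lphi B.
exists (`|M| * L) => x y xr yr.
rewrite (le_trans (phiM _ _ (fB _ xr) (fB _ yr)))//.
rewrite (@le_trans _ _ (`|M| * `|f x - f y|)) ?ler_wpM2r ?ler_norm//.
by rewrite -mulrA ler_wpM2l// fL.
Qed.

End locally_lipschitz.

Section partials.
Context {R : realType} {n : nat}.
Local Notation V := 'cV[R]_n.
Implicit Types (a v : V).

(** Total differentiability is bundled with explicit formulas for the partial derivatives, so that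
    the calculus rules below compute with formulas rather than with limits. *)
Definition has_partials (f : V -> R) (f1 : 'I_n -> V -> R) := forall a,
  differentiable f a /\ forall p, 'D_(delta_mx p 0) f a = f1 p a.

Lemma deriveE_partials (f : V -> R) f1 a v : has_partials f f1 ->
  'D_v f a = \sum_p f1 p a * v p 0.
Proof.
move=> /(_ a)[df fE]; rewrite deriveE//.
rewrite [in LHS](matrix_sum_delta v) linear_sum; apply: eq_bigr => p _.
by rewrite big_ord1 linearZ/= -deriveE// fE mulrC.
Qed.

(** Restriction to lines reduces the mean value, convexity and Taylor estimates below to functions
    of one variable. *)
Lemma is_derive_line (f : V -> R) f1 a v (t : R) : has_partials f f1 ->
  is_derive t 1 (fun s : R => f (a + s *: v)) (\sum_p f1 p (a + t *: v) * v p 0).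
Proof.
move=> pf; have [df _] := pf (a + t *: v).
have dl : is_diff t (fun s : R => a + s *: v) (fun s => s *: v).
  have -> : (fun s : R => a + s *: v) = cst a + *:%R ^~ v by [].
  rewrite -[X in is_diff _ _ X]add0r.
  exact: is_diffD (is_diff_cst a t) (is_diff_scalel t v).
have dc : differentiable (f \o (fun s : R => a + s *: v)) t.
  by apply: differentiable_comp.
apply: DeriveDef; first exact/derivable1_diffP.
rewrite -(deriveE_partials _ _ pf) !deriveE// diff_comp//=.
by rewrite diff_val scale1r.
Qed.

Lemma has_partials_ext (f : V -> R) f1 g1 : has_partials f f1 ->
  (forall p a, f1 p a = g1 p a) -> has_partials f g1.
Proof. by move=> pf E a; have [? h] := pf a; split=> // p; rewrite h. Qed.

Lemma has_partials_cst (c : R) : has_partials (fun=> c) (fun _ _ => 0).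
Proof. by move=> a; split => [|p]; [exact: differentiable_cst|exact: derive_cst]. Qed.

Lemma has_partials_coord (q : 'I_n) :
  has_partials (fun a => a q 0) (fun p _ => (q == p)%:R).
Proof.
move=> a; split => [|p]; first exact: differentiable_coord.
(* The difference quotient is constant for increments different from 0. *)
rewrite /derive; apply: cvg_lim => //; apply: cvg_near_cst.
near=> h; rewrite /= !mxE eqxx andbT addrK.
rewrite -[LHS]/(h^-1 * (h * _)) mulrA mulVf ?mul1r//.
by near: h; exact: nbhs_dnbhs_neq.
Unshelve. all: by end_near. Qed.

Lemma has_partialsD (f g : V -> R) f1 g1 : has_partials f f1 -> has_partials g g1 ->
  has_partials (fun a => f a + g a) (fun p a => f1 p a + g1 p a).
Proof.
move=> pf pg a; have [df fE] := pf a; have [dg gE] := pg a.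
split => [|p]; first exact: differentiableD.
by rewrite -fE -gE -deriveD//; exact: diff_derivable.
Qed.

Lemma has_partialsM (f g : V -> R) f1 g1 : has_partials f f1 -> has_partials g g1 ->
  has_partials (fun a => f a * g a) (fun p a => f1 p a * g a + f a * g1 p a).
Proof.
move=> pf pg a; have [df fE] := pf a; have [dg gE] := pg a.
split => [|p]; first exact: differentiableM.
rewrite -fE -gE -[(fun _ => _)]/(f * g) deriveM; try exact: diff_derivable.
by rewrite addrC; congr (_ + _); exact: mulrC.
Qed.

Lemma has_partials_comp (phi phi1 : R -> R) (f : V -> R) f1 :
  (forall x : R, is_derive x 1 phi (phi1 x)) -> has_partials f f1 ->
  has_partials (fun a => phi (f a)) (fun p a => phi1 (f a) * f1 p a).
Proof.
move=> dphi pf a; have [df fE] := pf a.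
have dp : differentiable phi (f a) by apply/derivable1_diffP.
split => [|p]; first exact: differentiable_comp.
rewrite -[(fun _ => _)]/(phi \o f) deriveE; last exact: differentiable_comp.
rewrite diff_comp//= -(deriveE (delta_mx p 0) df) fE.
(* A linear map on the line is multiplication by its value at 1. *)
have -> : 'd phi (f a) (f1 p a) = f1 p a * 'd phi (f a) 1.
  by rewrite -[RHS]/(_ *: _) -linearZ/=; congr ('d _ _ _); exact/esym/mulr1.
by rewrite -deriveE// (@derive_val _ _ _ _ _ _ _ (dphi (f a))) mulrC.
Qed.

Lemma has_partials_sum (I : finType) (F : I -> V -> R) F1 :
  (forall i, has_partials (F i) (F1 i)) ->
  has_partials (fun a => \sum_i F i a) (fun p a => \sum_i F1 i p a).
Proof.
move=> pF; have : forall s : seq I, has_partials (fun a => \sum_(i <- s) F i a)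
    (fun p a => \sum_(i <- s) F1 i p a).
  elim=> [|i s IH].
    rewrite [X in has_partials X](_ : _ = fun=> 0).
      by apply: has_partials_ext (has_partials_cst 0) _ => p a; rewrite big_nil.
    by apply/funext => a; rewrite big_nil.
  rewrite [X in has_partials X](_ : _ = fun a => F i a + \sum_(j <- s) F j a).
    apply: has_partials_ext (has_partialsD (pF i) IH) _ => p a.
    by rewrite big_cons.
  by apply/funext => a; rewrite big_cons.
exact.
Qed.

End partials.

(** * Comparison of the sup norm and the Euclidean norm *)

Section norms.
Context {R : realType} {n : nat}.
Local Notation V := 'cV[R]_n.
Implicit Types (a v x y : V).

Lemma coord_le_norm v p : `|v p 0| <= `|v|.
Proof.
have := lexx `|v|; rewrite {1}/Num.norm/= mx_normrE => /bigmax_leP[_ h].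
exact: (h (p, 0)).
Qed.

Lemma norm_le_coord v (B : R) : 0 <= B -> (forall p, `|v p 0| <= B) -> `|v| <= B.
Proof.
move=> B0 vB; rewrite /Num.norm/= mx_normrE; apply/bigmax_leP; split=> //.
by move=> [p q] _ /=; rewrite (ord1 q).
Qed.

Lemma coord_le_enorm v p : `|v p 0| <= enorm v.
Proof.
rewrite -sqrtr_sqr ler_wsqrtr// (bigD1 p)//= lerDl sumr_ge0// => i _.
exact: sqr_ge0.
Qed.

Lemma enorm_ge0 v : 0 <= enorm v. Proof. exact: sqrtr_ge0. Qed.

Lemma norm_le_enorm v : `|v| <= enorm v.
Proof. by apply: norm_le_coord => [|p]; [exact: enorm_ge0|exact: coord_le_enorm]. Qed.

Lemma sqr_enorm v : enorm v ^+ 2 = \sum_p v p 0 ^+ 2.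
Proof. by rewrite sqr_sqrtr// sumr_ge0// => i _; exact: sqr_ge0. Qed.

Lemma ler_sum_ord (F : 'I_n -> R) (B : R) : (forall p, F p <= B) ->
  \sum_p F p <= n%:R * B.
Proof.
move=> FB; rewrite (le_trans (ler_sum _ (fun p _ => FB p)))//.
by rewrite sumr_const card_ord mulr_natl.
Qed.

Lemma enorm_le v (B : R) : 0 <= B -> (forall p, `|v p 0| <= B) ->
  enorm v <= n%:R * B.
Proof.
move=> B0 vB; rewrite -(@ler_pXn2r _ 2)// ?nnegrE ?mulr_ge0 ?enorm_ge0//.
rewrite sqr_enorm exprMn (le_trans (@ler_sum_ord _ (B ^+ 2) _))// => [p|].
  by rewrite -(@real_normK _ (v p 0)) ?num_real// lerXn2r ?nnegrE.
rewrite ler_wpM2r ?sqr_ge0// -natrX ler_nat.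
by case: n => // m; rewrite expnS expn1 leq_pmulr.
Qed.

Lemma norm_dot_le (c : 'I_n -> R) v (B : R) : (forall p, `|c p| <= B) ->
  `|\sum_p c p * v p 0| <= n%:R * B * `|v|.
Proof.
move=> cB; rewrite (le_trans (ler_norm_sum _ _ _))// -mulrA ler_sum_ord// => p.
by rewrite normrM ler_pM// coord_le_norm.
Qed.

End norms.

(** * Mean value estimates along segments *)

Section mean_value.
Context {R : realType} {n : nat}.
Local Notation V := 'cV[R]_n.
Implicit Types (a v x y : V).

Lemma MVT_line (f : V -> R) f1 a v : has_partials f f1 ->
  exists t : R, [/\ 0 < t, t < 1 &
    f (a + v) - f a = \sum_p f1 p (a + t *: v) * v p 0].
Proof.
move=> pf; have dl := is_derive_line a v _ pf.
have [t|t t01 E] := @MVT R (fun s => f (a + s *: v)) _ 0 1 ltr01 (fun t _ => dl t).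
  apply/continuous_subspaceT => s; apply: differentiable_continuous.
  by have /@ex_derive/derivable1_diffP := dl s.
move: t01; rewrite in_itv/= => /andP[t0 t1]; exists t; split=> //.
by move: E; rewrite /= scale1r scale0r addr0 subr0 mulr1.
Qed.

Lemma mean_value_le (f : V -> R) f1 (B : R) x y :
  has_partials f f1 ->
  (forall t : R, 0 <= t -> t <= 1 -> forall p, `|f1 p (x + t *: (y - x))| <= B) ->
  `|f y - f x| <= n%:R * B * `|y - x|.
Proof.
move=> pf fB; have [t [t0 t1 E]] := MVT_line x (y - x) pf.
have yE : x + (y - x) = y by rewrite addrC subrK.
by rewrite -{1}yE E norm_dot_le// => p; rewrite fB// ltW.
Qed.

Lemma norm_segment_le a x y (t r : R) : 0 <= t -> t <= 1 ->
  `|x - a| <= r -> `|y - a| <= r -> `|x + t *: (y - x) - a| <= r.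
Proof.
move=> t0 t1 xr yr.
have -> : x + t *: (y - x) - a = (1 - t) *: (x - a) + t *: (y - a).
  by apply/matrixP => p q; rewrite !mxE; ring.
rewrite (le_trans (ler_normD _ _))// !normrZ !ger0_norm ?subr_ge0//.
have -> : r = (1 - t) * r + t * r by ring.
by rewrite lerD// ler_wpM2l// subr_ge0.
Qed.

(** The partial derivatives are bounded on each ball, and balls are convex, so the mean value
    estimate applies between any two points of a ball. *)
Lemma has_partials_llip (f : V -> R) f1 :
  has_partials f f1 -> (forall p, llip (f1 p)) -> llip f.
Proof.
move=> pf lf1 r.
have [B fB] : exists B : R, forall p x, `|x| <= r -> `|f1 p x| <= B.
  have /choice[B hB] : forall p, exists B : R, 0 <= B /\
      forall x, `|x| <= r -> `|f1 p x| <= B.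
    by move=> p; have [B B0 fB] := llip_bounded (lf1 p) r; exists B.
  (* The sum of the nonnegative bounds serves all coordinates at once. *)
  exists (\sum_p B p) => p x xr.
  rewrite (le_trans (proj2 (hB p) _ xr))// (bigD1 p)//= lerDl sumr_ge0// => i _.
  by have [] := hB i.
exists (n%:R * B) => x y xr yr; apply: (mean_value_le pf) => t t0 t1 p.
by apply: fB; rewrite -[X in `|X|]subr0 norm_segment_le ?subr0.
Qed.

End mean_value.

(** * Functions with explicit gradient and locally Lipschitz Hessian *)

Section jets.
Context {R : realType} {n : nat}.
Local Notation V := 'cV[R]_n.
Implicit Types (a v x y : V).

(** A local form of assumption A1 that is closed under sums, products and composition with
    one-variable functions; the perturbed costs are differentiated with these rules. The index order
    of [f2] is that of [hess]. *)
Definition jet2 (f : V -> R) f1 (f2 : 'I_n -> 'I_n -> V -> R) :=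
  [/\ has_partials f f1, forall p, has_partials (f1 p) (f2 p) &
      forall p q, llip (f2 p q)].

Lemma jet2_llip1 (f : V -> R) f1 f2 : jet2 f f1 f2 -> forall p, llip (f1 p).
Proof. by case=> _ pf1 lf2 p; exact: has_partials_llip (pf1 p) (lf2 p). Qed.

Lemma jet2_llip (f : V -> R) f1 f2 : jet2 f f1 f2 -> llip f.
Proof.
by move=> jf; have [pf _ _] := jf; exact: has_partials_llip pf (jet2_llip1 jf).
Qed.

Lemma jet2_ext (f : V -> R) f1 f2 g1 g2 : jet2 f f1 f2 ->
  (forall p a, f1 p a = g1 p a) -> (forall p q a, f2 p q a = g2 p q a) ->
  jet2 f g1 g2.
Proof.
move=> jf E1 E2; have -> : g1 = f1 by apply/funext => p; apply/funext => a.
have -> // : g2 = f2.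
by apply/funext => p; apply/funext => q; apply/funext => a.
Qed.

Lemma jet2_cst (c : R) : jet2 (fun=> c) (fun _ _ => 0) (fun _ _ _ => 0).
Proof.
split=> [|p|p q]; [exact: has_partials_cst|exact: has_partials_cst|].
exact: llip_cst.
Qed.

Lemma jet2_coord (r : 'I_n) :
  jet2 (fun a => a r 0) (fun p _ => (r == p)%:R) (fun _ _ _ => 0).
Proof.
split=> [|p|p q]; [exact: has_partials_coord|exact: has_partials_cst|].
exact: llip_cst.
Qed.

Lemma jet2D (f g : V -> R) f1 f2 g1 g2 : jet2 f f1 f2 -> jet2 g g1 g2 ->
  jet2 (fun a => f a + g a) (fun p a => f1 p a + g1 p a)
       (fun p q a => f2 p q a + g2 p q a).
Proof.
move=> [pf pf1 lf2] [pg pg1 lg2]; split=> [|p|p q]; try exact: has_partialsD.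
exact: llipD.
Qed.

Lemma jet2M (f g : V -> R) f1 f2 g1 g2 : jet2 f f1 f2 -> jet2 g g1 g2 ->
  jet2 (fun a => f a * g a) (fun p a => f1 p a * g a + f a * g1 p a)
       (fun p q a => (f2 p q a * g a + f1 p a * g1 q a)
                     + (f1 q a * g1 p a + f a * g2 p q a)).
Proof.
move=> jf jg; have [pf pf1 lf2] := jf; have [pg pg1 lg2] := jg.
split=> [|p|p q]; first exact: has_partialsM.
  exact: has_partialsD (has_partialsM (pf1 p) pg) (has_partialsM pf (pg1 p)).
have lf := jet2_llip jf; have lg := jet2_llip jg.
have lf1 := jet2_llip1 jf; have lg1 := jet2_llip1 jg.
by apply: llipD; apply: llipD; apply: llipM.
Qed.

Lemma jet2_comp (phi phi1 phi2 : R -> R) (f : V -> R) f1 f2 :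
  (forall x : R, is_derive x 1 phi (phi1 x)) ->
  (forall x : R, is_derive x 1 phi1 (phi2 x)) ->
  llip phi1 -> llip phi2 -> jet2 f f1 f2 ->
  jet2 (fun a => phi (f a)) (fun p a => phi1 (f a) * f1 p a)
    (fun p q a => phi2 (f a) * f1 q a * f1 p a + phi1 (f a) * f2 p q a).
Proof.
move=> d0 d1 l1 l2 jf; have [pf pf1 lf2] := jf.
have lf := jet2_llip jf; have lf1 := jet2_llip1 jf.
split=> [|p|p q]; first exact: has_partials_comp.
  exact: has_partialsM (has_partials_comp d1 pf) (pf1 p).
by apply: llipD; apply: llipM => //; [apply: llipM => //|]; exact: llip_comp.
Qed.

Lemma jet2_sum (I : finType) (F : I -> V -> R) F1 F2 :
  (forall i, jet2 (F i) (F1 i) (F2 i)) ->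
  jet2 (fun a => \sum_i F i a) (fun p a => \sum_i F1 i p a)
       (fun p q a => \sum_i F2 i p q a).
Proof.
move=> jF; split=> [|p|p q].
- by apply: has_partials_sum => i; have [] := jF i.
- by apply: has_partials_sum => i; have [_ +] := jF i; exact.
- by apply: llip_sum => i; have [_ _] := jF i; exact.
Qed.

Lemma jet2_grad (f : V -> R) f1 f2 a p : jet2 f f1 f2 -> grad f a p 0 = f1 p a.
Proof. by case=> pf _ _; rewrite mxE; have [_ ->] := pf a. Qed.

Lemma jet2_hess (f : V -> R) f1 f2 a p q :
  jet2 f f1 f2 -> hess f a p q = f2 p q a.
Proof.
move=> jf; have [_ pf1 _] := jf; rewrite mxE.
rewrite (_ : (fun x => _) = f1 p); first by have [_ ->] := pf1 p a.
by apply/funext => x; exact: jet2_grad jf.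
Qed.

Lemma C1_partials (f : V -> R) f1 :
  has_partials f f1 -> (forall p, continuous (f1 p)) -> C1 f.
Proof.
move=> pf cf1; split=> [a|]; first by have [] := pf a.
move=> a; apply/(@cvgrPdist_le R V V (nbhs a)) => e e0.
have : \forall x \near a, forall p, `|f1 p a - f1 p x| <= e.
  apply: (@filter_forall V 'I_n (fun p x => `|f1 p a - f1 p x| <= e) (nbhs a) _) => p.
  by apply: cvgr_dist_le => //; exact: cf1.
apply: filterS => x fx; apply: norm_le_coord => [|p]; first exact: ltW.
by rewrite !mxE; have [_ ->] := pf a; have [_ ->] := pf x.
Qed.

Lemma jet2_C2 (f : V -> R) f1 f2 : jet2 f f1 f2 -> C2 f.
Proof.
move=> jf; have [pf pf1 lf2] := jf; split=> [|p].
  by apply: C1_partials pf _ => p; exact: llip_continuous (jet2_llip1 jf p).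
rewrite (_ : (fun a => _) = f1 p).
  by apply: C1_partials (pf1 p) _ => q; exact: llip_continuous.
by apply/funext => a; exact: jet2_grad jf.
Qed.

End jets.

(** * Cutoff functions *)

Section cutoff.
Context {R : realType}.
Implicit Types s x : R.

Definition pos s : R := Num.max 0 s.

Lemma pos_ge0 s : 0 <= pos s. Proof. by rewrite /pos le_max lexx. Qed.

Lemma pos_le0 s : s <= 0 -> pos s = 0.
Proof. by move=> s0; rewrite /pos max_l. Qed.

Lemma pos_gt0 s : 0 <= s -> pos s = s.
Proof. by move=> s0; rewrite /pos max_r. Qed.

Lemma pos_llip : llip pos.
Proof.
move=> r; exists 1 => x y _ _; rewrite mul1r /pos.
have [x0|x0] := leP 0 x; have [y0|y0] := leP 0 y; rewrite ?subrr ?normr0//.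
  by rewrite subr0 ger0_norm// ler_normr; apply/orP; left; lra.
by rewrite sub0r normrN ger0_norm// ler_normr; apply/orP; right; lra.
Qed.

(** Away from 0 the function coincides locally with the square or with 0; at 0 the difference
    quotient at [h] is at most [|h|] in absolute value. *)
Lemma is_derive_pos2 x : is_derive x 1 (fun s => pos s ^+ 2) (2 * pos x).
Proof.
have [x0|x0|x0] := ltgtP 0 x.
- apply: (@near_eq_is_derive _ _ _ (fun s => s ^+ 2)).
    near=> s; rewrite pos_gt0//; apply/ltW; near: s; exact: lt_nbhsr.
  by rewrite pos_gt0 ?ltW//; apply: is_derive_eq; rewrite /GRing.scale/= mulr1 mulr_natl.
- apply: (@near_eq_is_derive _ _ _ (cst 0)).
    near=> s; rewrite pos_le0 ?expr0n//; apply/ltW; near: s; exact: lt_nbhsl.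
  by rewrite pos_le0 ?ltW// mulr0; exact: is_derive_cst.
- rewrite -x0 pos_le0// mulr0.
  have h : (fun h : R => h^-1 *: (pos (h *: (1 : R) + 0) ^+ 2 - pos 0 ^+ 2))
      @ 0^' --> (0 : R).
    apply/cvgrPdist_le => e e0; near=> h.
    rewrite sub0r normrN addr0 (pos_le0 (lexx 0)) expr0n/= subr0.
    rewrite /GRing.scale/= mulr1 normrM normfV.
    have h0 : h != 0 by near: h; exact: nbhs_dnbhs_neq.
    rewrite ler_pdivrMl ?normr_gt0// normrX ger0_norm ?pos_ge0//.
    have hp : pos h <= `|h| by rewrite /pos ge_max normr_ge0 ler_norm.
    rewrite expr2 ler_pM ?pos_ge0// (le_trans hp)//.
    near: h; apply: dnbhs0_le => //.
  by apply: DeriveDef; [exact: cvgP h|exact: cvg_lim h].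
Unshelve. all: by end_near. Qed.

(** The cube of the positive part is its square times the identity, so the product rule replaces
    another study of the kink at 0. *)
Lemma is_derive_pos3 x : is_derive x 1 (fun s => pos s ^+ 3) (3 * pos x ^+ 2).
Proof.
have -> : (fun s => pos s ^+ 3) = (fun s => pos s ^+ 2) * id.
  apply/funext => s; rewrite exprSr -[RHS]/(pos s ^+ 2 * s).
  have [s0|s0] := leP s 0; last by rewrite (pos_gt0 (ltW s0)).
  by rewrite pos_le0// !expr0n/= !mul0r.
have d := is_derive_pos2 x.
apply: is_derive_eq; rewrite /GRing.scale/= mulr1.
by have [s0|s0] := leP x 0; [rewrite pos_le0//|rewrite (pos_gt0 (ltW s0))]; ring.
Qed.

(* Splines, so that the second derivatives are Lipschitz; [eta2] is the hat
   function supported on [1, 3]. *)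
Definition eta s : R :=
  (pos (s - 1) ^+ 3 - 2 * pos (s - 2) ^+ 3 + pos (s - 3) ^+ 3) / 6.
Definition eta1 s : R :=
  (pos (s - 1) ^+ 2 - 2 * pos (s - 2) ^+ 2 + pos (s - 3) ^+ 2) / 2.
Definition eta2 s : R := pos (s - 1) - 2 * pos (s - 2) + pos (s - 3).

(** The inner cube makes the function leave the value 1 with two vanishing derivatives at 2; the
    outer cube does the same for the value 0 at 3. *)
Definition chi s : R := pos (1 - pos (s - 2) ^+ 3) ^+ 3.
Definition chi1 s : R :=
  - (9 * pos (1 - pos (s - 2) ^+ 3) ^+ 2 * pos (s - 2) ^+ 2).
Definition chi2 s : R :=
  54 * pos (1 - pos (s - 2) ^+ 3) * pos (s - 2) ^+ 4
  - 18 * pos (1 - pos (s - 2) ^+ 3) ^+ 2 * pos (s - 2).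

Lemma is_derive_comp1 (f g : R -> R) (df dg x : R) :
  is_derive (g x) 1 f df -> is_derive x 1 g dg ->
  is_derive x 1 (fun s => f (g s)) (df * dg).
Proof.
move=> dF dG.
have F : differentiable f (g x) by apply/derivable1_diffP.
have G : differentiable g x by apply/derivable1_diffP.
have FG : differentiable (f \o g) x by apply: differentiable_comp.
apply: DeriveDef; first exact/derivable1_diffP.
rewrite -derive1E derive1_comp; try exact/derivable1_diffP.
by rewrite !derive1E !derive_val.
Qed.

Lemma is_derive_pos3_sub (c x : R) :
  is_derive x 1 (fun s => pos (s - c) ^+ 3) (3 * pos (x - c) ^+ 2).
Proof.
have := @is_derive_comp1 (fun s => pos s ^+ 3) (fun s => s - c) _ 1 x (is_derive_pos3 _).
rewrite mulr1; apply.
by apply: is_derive_eq; rewrite subr0.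
Qed.

Lemma is_derive_pos2_sub (c x : R) :
  is_derive x 1 (fun s => pos (s - c) ^+ 2) (2 * pos (x - c)).
Proof.
have := @is_derive_comp1 (fun s => pos s ^+ 2) (fun s => s - c) _ 1 x (is_derive_pos2 _).
rewrite mulr1; apply.
by apply: is_derive_eq; rewrite subr0.
Qed.

Lemma is_derive_eta x : is_derive x 1 eta (eta1 x).
Proof.
have d1 := is_derive_pos3_sub 1 x; have d2 := is_derive_pos3_sub 2 x.
have d3 := is_derive_pos3_sub 3 x.
rewrite (_ : eta = (6^-1 : R) *: ((fun s => pos (s - 1) ^+ 3)
   - (2 : R) *: (fun s => pos (s - 2) ^+ 3) + (fun s => pos (s - 3) ^+ 3))).
  by apply: is_derive_eq; rewrite /eta1 /GRing.scale/=; field.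
by apply/funext => s; rewrite /eta mulrC.
Qed.

Lemma is_derive_eta1 x : is_derive x 1 eta1 (eta2 x).
Proof.
have d1 := is_derive_pos2_sub 1 x; have d2 := is_derive_pos2_sub 2 x.
have d3 := is_derive_pos2_sub 3 x.
rewrite (_ : eta1 = (2^-1 : R) *: ((fun s => pos (s - 1) ^+ 2)
   - (2 : R) *: (fun s => pos (s - 2) ^+ 2) + (fun s => pos (s - 3) ^+ 2))).
  by apply: is_derive_eq; rewrite /eta2 /GRing.scale/=; field.
by apply/funext => s; rewrite /eta1 mulrC.
Qed.

Lemma is_derive_chi_arg x :
  is_derive x 1 (fun s => 1 - pos (s - 2) ^+ 3) (- (3 * pos (x - 2) ^+ 2)).
Proof.
have d := is_derive_pos3_sub 2 x.
rewrite [X in is_derive _ _ X](_ : _ = cst 1 - (fun s => pos (s - 2) ^+ 3))//.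
by apply: is_derive_eq; rewrite sub0r.
Qed.

Lemma is_derive_chi x : is_derive x 1 chi (chi1 x).
Proof.
have d := @is_derive_comp1 (fun s => pos s ^+ 3) _ _ _ x (is_derive_pos3 _)
   (is_derive_chi_arg x).
by rewrite /chi; apply: is_derive_eq; rewrite /chi1; ring.
Qed.

Lemma is_derive_chi1 x : is_derive x 1 chi1 (chi2 x).
Proof.
have d1 := @is_derive_comp1 (fun s => pos s ^+ 2) _ _ _ x (is_derive_pos2 _)
   (is_derive_chi_arg x).
have d2 := is_derive_pos2_sub 2 x.
rewrite (_ : chi1 = (- 9 : R) *: ((fun s => pos (1 - pos (s - 2) ^+ 3) ^+ 2)
   * (fun s => pos (s - 2) ^+ 2))).
  by apply: is_derive_eq; rewrite /chi2 /GRing.scale/=; ring.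
by apply/funext => s; rewrite /chi1 -mulrA -mulNr.
Qed.

Lemma llip_id : llip (@id R).
Proof. by move=> r; exists 1 => x y _ _; rewrite mul1r. Qed.

Lemma llipX (f : R -> R) k : llip f -> llip (fun s => f s ^+ k).
Proof.
move=> lf; elim: k => [|k IH]; first exact: llip_cst.
rewrite [X in llip X](_ : _ = fun s => f s * f s ^+ k); first exact: llipM.
by apply/funext => s; rewrite exprS.
Qed.

Lemma llip_pos_sub c : llip (fun s => pos (s - c)).
Proof.
by apply: llip_comp; [exact: llipD llip_id (llip_cst (- c))|exact: pos_llip].
Qed.

Lemma llip_chi_arg : llip (fun s => pos (1 - pos (s - 2) ^+ 3)).
Proof.
apply: (@llip_comp _ _ pos); last exact: pos_llip.
apply: llipD (llip_cst 1) _.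
rewrite [X in llip X](_ : _ = fun s => (-1) * pos (s - 2) ^+ 3).
  exact: llipM (llip_cst _) (llipX _ (llip_pos_sub _)).
by apply/funext => s; rewrite mulN1r.
Qed.

Lemma llip_eta2 : llip eta2.
Proof.
rewrite (_ : eta2 = fun s => (pos (s - 1) + (-2) * pos (s - 2)) + pos (s - 3)).
  apply: llipD (llip_pos_sub _); apply: llipD (llip_pos_sub _) _.
  exact: llipM (llip_cst _) (llip_pos_sub _).
by apply/funext => s; rewrite /eta2; ring.
Qed.

Lemma llip_eta1 : llip eta1.
Proof.
rewrite (_ : eta1 = fun s => 2^-1 * ((pos (s - 1) ^+ 2 + (-2) * pos (s - 2) ^+ 2)
    + pos (s - 3) ^+ 2)).
  apply: llipM (llip_cst _) _; apply: llipD (llipX _ (llip_pos_sub _)).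
  apply: llipD (llipX _ (llip_pos_sub _)) _.
  exact: llipM (llip_cst _) (llipX _ (llip_pos_sub _)).
by apply/funext => s; rewrite /eta1; ring.
Qed.

Lemma llip_chi1 : llip chi1.
Proof.
rewrite (_ : chi1 = fun s => (-9) * (pos (1 - pos (s - 2) ^+ 3) ^+ 2
    * pos (s - 2) ^+ 2)).
  apply: llipM (llip_cst _) _.
  exact: llipM (llipX _ llip_chi_arg) (llipX _ (llip_pos_sub _)).
by apply/funext => s; rewrite /chi1; ring.
Qed.

Lemma llip_chi2 : llip chi2.
Proof.
rewrite (_ : chi2 = fun s => 54 * (pos (1 - pos (s - 2) ^+ 3) * pos (s - 2) ^+ 4)
  + (-18) * (pos (1 - pos (s - 2) ^+ 3) ^+ 2 * pos (s - 2))).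
  apply: llipD; apply: llipM (llip_cst _) _.
    exact: llipM llip_chi_arg (llipX _ (llip_pos_sub _)).
  exact: llipM (llipX _ llip_chi_arg) (llip_pos_sub _).
by apply/funext => s; rewrite /chi2; ring.
Qed.

Lemma eta_inner s : s <= 1 -> eta s = 0 /\ eta1 s = 0.
Proof.
move=> s1; rewrite /eta /eta1 !pos_le0; lra.
Qed.

Lemma eta_rise s : 1 <= s -> s <= 2 ->
  eta1 s = (s - 1) ^+ 2 / 2 /\ eta2 s = s - 1.
Proof.
move=> s1 s2; rewrite /eta1 /eta2 (pos_gt0 (s := s - 1)) ?pos_le0; lra.
Qed.

Lemma eta_flatten s : 2 <= s -> s <= 3 ->
  eta1 s = 1 - (3 - s) ^+ 2 / 2 /\ eta2 s = 3 - s.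
Proof.
move=> s2 s3; rewrite /eta1 /eta2 (pos_le0 (s := s - 3)) ?pos_gt0; lra.
Qed.

Lemma eta_outer s : 3 <= s -> eta1 s = 1 /\ eta2 s = 0.
Proof.
move=> s1; rewrite /eta1 /eta2 !pos_gt0; lra.
Qed.

Lemma eta_bounds s : [/\ 0 <= eta1 s, eta1 s <= 1 & 0 <= eta2 s].
Proof.
have [s1|/ltW s1] := leP s 1.
  have [_ ->] := eta_inner s1.
  by rewrite /eta2 !pos_le0 ?mulr0 ?subr0 ?addr0 ?ler01//; lra.
have [s2|/ltW s2] := leP s 2; first by have [-> ->] := eta_rise s1 s2; split; nra.
have [s3|/ltW s3] := leP s 3; last by have [-> ->] := eta_outer s3; split; lra.
by have [-> ->] := eta_flatten s2 s3; split; nra.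
Qed.

Lemma eta1_ge_half s : 2 <= s -> 1 / 2 <= eta1 s.
Proof.
move=> s2; have [s3|/ltW s3] := leP s 3; last by have [-> _] := eta_outer s3; lra.
by have [-> _] := eta_flatten s2 s3; nra.
Qed.

Lemma chi_inner s : s <= 2 -> [/\ chi s = 1, chi1 s = 0 & chi2 s = 0].
Proof.
move=> s2; rewrite /chi /chi1 /chi2 (pos_le0 (s := s - 2)); last lra.
by rewrite !expr0n/= subr0 pos_gt0// !mulr0 expr1n subr0 oppr0.
Qed.

Lemma chi_outer s : 3 <= s -> [/\ chi s = 0, chi1 s = 0 & chi2 s = 0].
Proof.
move=> s3; rewrite /chi /chi1 /chi2 (pos_le0 (s := 1 - _)).
  by rewrite !expr0n/= !mulr0 !mul0r subr0 oppr0.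
rewrite pos_gt0; last lra.
by rewrite subr_le0 -(expr1n _ 3) lerXn2r ?nnegrE//; lra.
Qed.

(** On [2, 3] both q = s - 2 and w = 1 - q^3 lie in [0, 1], so the bounds can be read off the
    coefficients: 9, and 72 = 54 + 18. *)
Lemma chi_bounds s :
  [/\ 0 <= chi s, chi s <= 1, `|chi1 s| <= 9 & `|chi2 s| <= 72].
Proof.
have [s2|/ltW s2] := leP s 2.
  by have [-> -> ->] := chi_inner s2; rewrite normr0; split; lra.
have [s3|/ltW s3] := leP s 3; last first.
  by have [-> -> ->] := chi_outer s3; rewrite normr0; split; lra.
rewrite /chi /chi1 /chi2 (pos_gt0 (s := s - 2)); last lra.
set q := s - 2; have q0 : 0 <= q by rewrite /q; lra.
have q1 : q <= 1 by rewrite /q; lra.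
have qX k : q ^+ k <= 1 by rewrite exprn_ile1.
rewrite pos_gt0 ?subr_ge0//; set w := 1 - q ^+ 3.
have w0 : 0 <= w by rewrite subr_ge0.
have w1 : w <= 1 by rewrite lerBlDr lerDl exprn_ge0.
have wX k : w ^+ k <= 1 by rewrite exprn_ile1.
have wq i j : 0 <= w ^+ i * q ^+ j <= 1.
  by rewrite mulr_ge0 ?exprn_ge0// mulr_ile1 ?exprn_ge0.
split; [exact: exprn_ge0|exact: wX| |].
  by rewrite normrN; have /andP[] := wq 2 2; rewrite ler_norml; lra.
have /andP[] := wq 1 4; have /andP[] := wq 2 1.
by rewrite !expr1 ler_norml; lra.
Qed.

End cutoff.

(** * Convexity, symmetry of second derivatives and Taylor bounds *)

Section real_functions.
Context {R : realType}.

(** The limit of the difference quotient can be taken from the right. This suits convexity and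
    optimality, which control increments only along a segment starting at the point. *)
Lemma is_derive_right_le (u : R -> R) (d D : R) : is_derive (0 : R) 1 u d ->
  (forall t, 0 < t -> t <= 1 -> u t - u 0 <= D * t) -> d <= D.
Proof.
move=> [du <-] uD; rewrite leNgt; apply/negP => Dd.
have : \forall t \near 0^', D < t^-1 *: (u (t *: (1 : R) + 0) - u 0).
  by apply: cvgr_gt du _ Dd.
move=> /nbhs_ballP[e /= e0 he].
(* Small enough for the quotient to exceed [D], and at most 1 so that the assumed bound applies and
   contradicts this. *)
pose t := Num.min (e / 2) 1.
have t0 : 0 < t by rewrite lt_min divr_gt0//= ltr01.
have te : t < e by rewrite gt_min ltr_pdivrMr// ltr_pMr// ltr1n.
have := he t; rewrite /ball/= sub0r normrN gtr0_norm// => /(_ te).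
rewrite gt_eqF// => /(_ isT); apply/negP; rewrite -leNgt.
rewrite /GRing.scale/= mulr1 addr0 mulrC ler_pdivrMr//.
by rewrite uD// ge_min lexx orbT.
Qed.

Lemma is_derive_right_ge (u : R -> R) (d D : R) : is_derive (0 : R) 1 u d ->
  (forall t, 0 < t -> t <= 1 -> D * t <= u t - u 0) -> D <= d.
Proof.
move=> du uD; rewrite -lerN2; have dN := is_deriveN du.
apply: (is_derive_right_le dN) => t t0 t1.
by rewrite -[leLHS]/(- u t - - u 0) -opprD mulNr lerN2 uD.
Qed.

Lemma MVT_derive (u u1 : R -> R) (a b : R) : (forall t : R, is_derive t 1 u (u1 t)) -> a < b ->
  exists c, [/\ a < c, c < b & u b - u a = u1 c * (b - a)].
Proof.
move=> du ab; have [|c + E] := MVT ab (fun t _ => du t).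
  apply/continuous_subspaceT => s; apply: differentiable_continuous.
  by have /@ex_derive/derivable1_diffP := du s.
by rewrite in_itv/= => /andP[ac cb]; exists c.
Qed.

(** The slopes of [u] on [0, t] and [t, 1] are values of [u1] at points c < d, and [u1] is
    nondecreasing by the mean value theorem. *)
Lemma derive2_ge0_convex (u u1 u2 : R -> R) (t : R) :
  (forall t : R, is_derive t 1 u (u1 t)) ->
  (forall t : R, is_derive t 1 u1 (u2 t)) -> (forall t, 0 <= u2 t) ->
  0 <= t -> t <= 1 -> u t <= (1 - t) * u 0 + t * u 1.
Proof.
move=> du du1 u2_ge0; rewrite le_eqVlt => /predU1P[<- _|t0].
  by rewrite subr0 mul1r mul0r addr0.
rewrite le_eqVlt => /predU1P[->|t1]; first by rewrite subrr mul0r mul1r add0r.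
have [c [c0 ct Ec]] := MVT_derive du t0.
have [d [td d1 Ed]] := MVT_derive du t1.
have [e [_ _ Ee]] := MVT_derive du1 (lt_trans ct td).
have cd : u1 c <= u1 d.
  by rewrite -subr_ge0 Ee mulr_ge0// subr_ge0 ltW// (lt_trans ct).
rewrite subr0 in Ec.
have : (1 - t) * (u t - u 0) <= t * (u 1 - u t).
  rewrite Ec Ed [leLHS](_ : _ = (t * (1 - t)) * u1 c); last by ring.
  rewrite [leRHS](_ : _ = (t * (1 - t)) * u1 d); last by ring.
  by rewrite ler_wpM2l// mulr_ge0 ?subr_ge0 ?ltW.
lra.
Qed.

End real_functions.

(** * Convexity along a direction and the Hessian quadratic form *)

Section lines.
Context {R : realType} {n : nat}.
Local Notation V := 'cV[R]_n.
Implicit Types (a v x y : V).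

Definition qform (H : 'I_n -> 'I_n -> R) v : R :=
  \sum_p \sum_q H p q * v q 0 * v p 0.

(** Taken for the directions that move only the coordinates of one player, this is player-wise
    convexity without reference to blocks. *)
Definition convex_along (f : V -> R) v := forall a (t : R), 0 <= t -> t <= 1 ->
  f (a + t *: v) <= (1 - t) * f a + t * f (a + v).

Lemma is_derive_line2 (f : V -> R) f1 f2 a v (t : R) : jet2 f f1 f2 ->
  is_derive t 1 (fun s : R => \sum_p f1 p (a + s *: v) * v p 0)
    (qform (fun p q => f2 p q (a + t *: v)) v).
Proof.
move=> [_ pf1 _].
have : has_partials (fun x : V => \sum_p f1 p x * v p 0)
    (fun q x => \sum_p f2 p q x * v p 0).
  apply: has_partials_sum => p.
  apply: has_partials_ext (has_partialsM (pf1 p) (has_partials_cst (v p 0))) _.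
  by move=> q x; rewrite mulr0 addr0.
move=> pg; suff <- : \sum_q (\sum_p f2 p q (a + t *: v) * v p 0) * v q 0 =
    qform (fun p q => f2 p q (a + t *: v)) v by exact: is_derive_line pg.
rewrite /qform exchange_big/=; apply: eq_bigr => q _.
by rewrite mulr_suml; apply: eq_bigr => p _; rewrite mulrAC.
Qed.

Lemma qform_ge0_convex (f : V -> R) f1 f2 v : jet2 f f1 f2 ->
  (forall a, 0 <= qform (fun p q => f2 p q a) v) -> convex_along f v.
Proof.
move=> jf f2_ge0 a t t0 t1; have [pf _ _] := jf.
have := @derive2_ge0_convex _ (fun s => f (a + s *: v)) _ _ t
  (fun s => is_derive_line a v s pf) (fun s => is_derive_line2 a v s jf)
  (fun s => f2_ge0 _) t0 t1.
by rewrite scale0r scale1r addr0.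
Qed.

Lemma convex_along_grad (f : V -> R) f1 a v : has_partials f f1 ->
  convex_along f v -> \sum_p f1 p a * v p 0 <= f (a + v) - f a.
Proof.
move=> pf cf; have := is_derive_line a v 0 pf; rewrite scale0r addr0.
move=> /is_derive_right_le; apply => t t0 t1; rewrite scale0r addr0.
by have := cf a t (ltW t0) t1; lra.
Qed.

(** Adding the gradient inequalities at a and at a + tv, for the increments tv and -tv, shows that
    the derivative in direction v does not decrease from a to a + tv; the quadratic form is the
    derivative of this quantity at t = 0. *)
Lemma convex_along_qform (f : V -> R) f1 f2 a v : jet2 f f1 f2 ->
  (forall k, convex_along f (k *: v)) -> 0 <= qform (fun p q => f2 p q a) v.
Proof.
move=> jf cf; have [pf _ _] := jf.
have := is_derive_line2 a v 0 jf; rewrite scale0r addr0 => d.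
apply: (is_derive_right_ge d) => t t0 t1; rewrite mul0r subr_ge0.
rewrite scale0r addr0 -(ler_pM2l t0).
have E (x w : V) (k : R) : k * (\sum_p f1 p x * w p 0) = \sum_p f1 p x * (k *: w) p 0.
  by rewrite mulr_sumr; apply: eq_bigr => p _; rewrite mxE; ring.
rewrite !E.
have h1 := convex_along_grad a pf (cf t).
have h2 := convex_along_grad (a + t *: v) pf (cf (- t)).
rewrite scaleNr addrK -scaleNr in h2.
have := E (a + t *: v) (t *: v) (-1); rewrite scalerA mulN1r mulN1r => h3.
rewrite -h3 in h2; lra.
Qed.

End lines.

(** * Symmetry of the Hessian and Taylor remainders *)

Section taylor.
Context {R : realType} {n : nat}.
Local Notation V := 'cV[R]_n.
Implicit Types (a v x y : V).

Lemma has_partials_shift (f : V -> R) f1 c : has_partials f f1 ->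
  has_partials (fun x => f (x + c)) (fun p x => f1 p (x + c)).
Proof.
move=> pf a; have [df fE] := pf (a + c); split=> [|p].
  have ds : differentiable (fun x : V => x + c) a.
    by apply: differentiableD.
  exact: (differentiable_comp ds df).
have E v : (fun h : R => h^-1 *: (((fun x => f (x + c)) \o shift a) (h *: v)
      - f (a + c))) =
    (fun h => h^-1 *: ((f \o shift (a + c)) (h *: v) - f (a + c))).
  by apply/funext => h; rewrite /= addrA.
by rewrite -fE /derive E.
Qed.

(** The mean value theorem is applied twice: to the increment of [f] in direction q, along direction
    p, and then to the p-th partial derivative along direction q. *)
Lemma double_difference (f : V -> R) f1 f2 a p q (t : R) : jet2 f f1 f2 -> 0 < t ->
  exists2 b : V, `|b - a| <= 2 * t &
    f (a + t *: delta_mx p 0 + t *: delta_mx q 0) - f (a + t *: delta_mx p 0)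
      - (f (a + t *: delta_mx q 0) - f a) = f2 p q b * t ^+ 2.
Proof.
move=> [pf pf1 _] t0.
have sumE (F : 'I_n -> R) r : \sum_i F i * (t *: delta_mx r 0 : V) i 0 = F r * t.
  rewrite (bigD1 r)//= !mxE !eqxx mulr1 big1 ?addr0// => i ir.
  by rewrite !mxE (negbTE ir) !mulr0.
have norm_delta (s : R) r : 0 <= s -> s <= 1 ->
    `|s *: (t *: delta_mx r 0 : V)| <= t.
  move=> s0 s1; apply: norm_le_coord => [|i]; first exact: ltW.
  rewrite !mxE !normrM (ger0_norm s0) (gtr0_norm t0).
  rewrite -[leRHS]mul1r ler_pM// ?mulr_ge0 ?(ltW t0)//.
  by case: (_ && _); rewrite ?normr1 ?mulr1// normr0 mulr0 ltW.
set ep := t *: delta_mx p 0; set eq := t *: delta_mx q 0.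
have ph := has_partialsD (has_partials_shift eq pf)
   (has_partialsM (has_partials_cst (-1)) pf).
have [s [s0 s1 Es]] := MVT_line a ep ph.
have [r [r0 r1 Er]] := MVT_line (a + s *: ep) eq (pf1 p).
exists (a + s *: ep + r *: eq).
  rewrite -[_ + _ + r *: eq]addrA addrAC subrr add0r (le_trans (ler_normD _ _))//.
  rewrite mulr_natl mulr2n lerD//.
    by apply: norm_delta; exact: ltW.
  by apply: norm_delta; exact: ltW.
move: Es; rewrite /ep sumE -/ep !mul0r !add0r !mulN1r Er sumE => Es.
rewrite expr2 mulrA -Es; ring.
Qed.

(** The double difference is symmetric in p and q, so [f2 p q] at some point within 2t of a equals
    [f2 q p] at another such point. Lipschitz continuity lets t tend to 0. *)
Lemma schwarz (f : V -> R) f1 f2 a p q : jet2 f f1 f2 -> f2 p q a = f2 q p a.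
Proof.
move=> jf; have [_ _ lf2] := jf.
have [L L0 fL] := llip_ge0 (lf2 p q) (`|a| + 2).
have [M M0 fM] := llip_ge0 (lf2 q p) (`|a| + 2).
have small t : 0 < t -> t <= 1 ->
    `|f2 p q a - f2 q p a| <= (L + M) * (2 * t).
  move=> t0 t1.
  have [b ba Eb] := double_difference a p q jf t0.
  have [c ca Ec] := double_difference a q p jf t0.
  have bc : f2 p q b = f2 q p c.
    have tn0 : t ^+ 2 != 0 by rewrite expf_neq0// gt_eqF.
    apply: (mulIf tn0); rewrite -Eb -Ec.
    by rewrite [a + _ + _]addrAC; ring.
  have near_a d : `|d - a| <= 2 * t -> `|d| <= `|a| + 2.
    move=> da; rewrite -(subrK a d) addrC (le_trans (ler_normD _ _))// lerD2l.
    by rewrite (le_trans da)//; lra.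
  rewrite (_ : _ - _ = (f2 p q a - f2 p q b) + (f2 q p c - f2 q p a)); last first.
    by rewrite bc; ring.
  rewrite (le_trans (ler_normD _ _))// mulrDl lerD//.
    rewrite (le_trans (fL _ _ _ (near_a _ ba))) ?lerDl// distrC.
    exact: ler_wpM2l.
  rewrite (le_trans (fM _ _ (near_a _ ca) _)) ?lerDl//.
  exact: ler_wpM2l.
apply/eqP; rewrite -subr_eq0 -normr_le0; apply/ler_addgt0Pr => e e0.
(* This makes (L + M) * 2t at most e; the added 1 keeps the denominator positive. *)
pose t := Num.min (e / ((L + M + 1) * 2)) 1.
have t0 : 0 < t by rewrite lt_min ltr01 andbT divr_gt0// mulr_gt0// ltr_wpDl// addr_ge0.
rewrite add0r (le_trans (small t t0 _)) ?ge_min ?lexx ?orbT//.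
have : t <= e / ((L + M + 1) * 2) by rewrite ge_min lexx.
rewrite ler_pdivlMr ?mulr_gt0// ?ltr_wpDl// ?addr_ge0// => h.
nra.
Qed.

(** Used both for Taylor polynomials centered at [y] and, with a scalar matrix, for the scaled
    squared distance [sqdist]. *)
Definition quad (c : R) (b : 'I_n -> R) (H : 'I_n -> 'I_n -> R) y a : R :=
  c + \sum_p b p * (a p 0 - y p 0)
  + 2^-1 * \sum_p \sum_q H p q * ((a p 0 - y p 0) * (a q 0 - y q 0)).

(** The quadratic term has gradient given by the symmetric part of [H]. For Taylor polynomials the
    symmetry is supplied by [schwarz]. *)
Lemma jet2_quad c b H y : (forall p q, H p q = H q p) ->
  jet2 (quad c b H y) (fun p a => b p + \sum_q H p q * (a q 0 - y q 0))
    (fun p q _ => H p q).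
Proof.
move=> Hsym.
have jz r := jet2D (@jet2_coord R n r) (jet2_cst (- y r 0)).
have jl := jet2_sum (fun r => jet2M (jet2_cst (b r)) (jz r)).
have jq := jet2_sum (fun r => jet2_sum (fun q =>
  jet2M (jet2_cst (H r q)) (jet2M (jz r) (jz q)))).
have sumE (F : 'I_n -> R) p : \sum_r F r * (r == p)%:R = F p.
  rewrite (bigD1 p)//= eqxx mulr1 big1 ?addr0// => i ip.
  by rewrite (negbTE ip) mulr0.
apply: jet2_ext (jet2D (jet2D (jet2_cst c) jl) (jet2M (jet2_cst 2^-1) jq)) _ _.
- move=> p a; rewrite !mul0r !add0r.
  rewrite (eq_bigr (fun r => b r * (r == p)%:R)) => [|r _]; last by ring.
  rewrite sumE; congr (_ + _).
  rewrite (eq_bigr (fun r => (\sum_q H r q * (a q 0 - y q 0)) * (r == p)%:R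
      + H r p * (a r 0 - y r 0))) => [|r _].
    rewrite big_split/= sumE [X in _ + X](eq_bigr (fun q => H p q * (a q 0 - y q 0))).
      by field.
    by move=> q _; rewrite Hsym.
  rewrite mulr_suml -[H r p * _]/(((fun q => H r q * (a r 0 - y r 0)) p)) -sumE -big_split/=.
  by apply: eq_bigr => q _; ring.
- move=> p q a; rewrite [X in _ + X + _]big1 => [|r _]; last by ring.
  rewrite !mul0r !add0r (eq_bigr (fun r => H r q * (r == p)%:R + H r p * (r == q)%:R)).
    by rewrite big_split/= !sumE (Hsym q p); field.
  move=> r _.
  rewrite -[H r q]/((fun s => H r s) q) -(sumE _ q) -[H r p]/((fun s => H r s) p) -(sumE _ p).
  by rewrite !mulr_suml -big_split/=; apply: eq_bigr => s _; ring.
Qed.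

(** On the segment from y to a the Hessian entries are at most L|a - y|, and the mean value estimate
    adds one more factor |a - y|. *)
Lemma taylor1_le (g : V -> R) g1 g2 y a (L : R) : 0 <= L -> jet2 g g1 g2 ->
  (forall p q x, `|g2 p q x| <= L * `|x - y|) -> (forall p, g1 p y = 0) ->
  forall p, `|g1 p a| <= n%:R * L * `|a - y| ^+ 2.
Proof.
move=> L0 [_ pg1 _] gL g1y p.
rewrite (_ : _ * _ = n%:R * (L * `|a - y|) * `|a - y|); last by ring.
rewrite -[g1 p a]subr0 -(g1y p).
apply: (mean_value_le (pg1 p)) => t t0 t1 q.
rewrite (le_trans (gL _ _ _))// ler_wpM2l// addrAC subrr add0r normrZ.
by rewrite ger0_norm// -[leRHS]mul1r ler_wpM2r.
Qed.

Lemma taylor2_le (g : V -> R) g1 g2 y a (L : R) : 0 <= L -> jet2 g g1 g2 ->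
  (forall p q x, `|g2 p q x| <= L * `|x - y|) -> (forall p, g1 p y = 0) ->
  g y = 0 -> `|g a| <= n%:R ^+ 2 * L * `|a - y| ^+ 3.
Proof.
move=> L0 jg gL g1y gy; have [pg _ _] := jg.
rewrite (_ : _ * _ = n%:R * (n%:R * L * `|a - y| ^+ 2) * `|a - y|); last by ring.
rewrite -[g a]subr0 -gy; apply: (mean_value_le pg) => t t0 t1 p.
rewrite (le_trans (taylor1_le _ L0 jg gL g1y p))// ler_wpM2l ?mulr_ge0//.
rewrite addrAC subrr add0r normrZ ger0_norm// lerXn2r ?nnegrE ?mulr_ge0//.
by rewrite -[leRHS]mul1r ler_wpM2r.
Qed.

End taylor.

(** * Nash equilibria as solutions of a variational inequality *)

Section blocks.
Context {R : realType} {N : nat} {n_ : 'I_N -> nat}.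
Local Notation profile := 'cV[R]_(\sum_(i < N) n_ i).
Implicit Types (a x v : profile).

Local Notation owner := (@tagnat.sig1 N n_).

Lemma deviate_coord a i (w : 'cV[R]_(n_ i)) p :
  deviate a w p 0 = eqtype.dfwith (submxcol a) w (owner p) (tagnat.sig2 p) 0.
Proof. by rewrite mxE. Qed.

Lemma submxcol_coord a p : a p 0 = submxcol a (owner p) (tagnat.sig2 p) 0.
Proof. by rewrite mxE tagnat.sig2K. Qed.

(** A unilateral deviation becomes a translation by a vector supported on the block of player i,
    which makes the results on lines available. *)
Lemma deviateE a i (w : 'cV[R]_(n_ i)) :
  deviate a w = a + deviate 0 (w - submxcol a i).
Proof.
apply/colP => p; rewrite [RHS]mxE [a p 0]submxcol_coord !deviate_coord.
move: (owner p) (tagnat.sig2 p) => j k.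
have [ij|ij] := eqVneq i j; first by subst j; rewrite !dfwith_in !mxE addrC subrK.
by rewrite !dfwith_out// submxcol0 [X in _ + X]mxE addr0.
Qed.

Lemma deviate0_out i (w : 'cV[R]_(n_ i)) p : owner p != i -> deviate 0 w p 0 = 0.
Proof.
by move=> pi; rewrite deviate_coord dfwith_out 1?eq_sym// submxcol0 mxE.
Qed.

Lemma deviate0_submxcol v p :
  deviate 0 (submxcol v (owner p)) p 0 = v p 0.
Proof. by rewrite deviate_coord dfwith_in -submxcol_coord. Qed.

Lemma deviate0Z i (k : R) (w : 'cV[R]_(n_ i)) :
  deviate 0 (k *: w) = k *: deviate 0 w.
Proof.
apply/colP => p; rewrite [RHS]mxE !deviate_coord.
move: (owner p) (tagnat.sig2 p) => j r.
have [ij|ij] := eqVneq i j; first by subst j; rewrite !dfwith_in !mxE.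
by rewrite !dfwith_out// submxcol0 !mxE mulr0.
Qed.

Lemma line_deviate a i (t : R) (w : 'cV[R]_(n_ i)) :
  a + t *: deviate 0 w = deviate a (submxcol a i + t *: w).
Proof. by rewrite [RHS]deviateE addrAC subrr add0r deviate0Z. Qed.

Lemma submxcol_deviate a i (w : 'cV[R]_(n_ i)) : submxcol (deviate a w) i = w.
Proof. by rewrite /deviate mxcolK dfwith_in. Qed.

Lemma deviate_deviate a i (w w' : 'cV[R]_(n_ i)) :
  deviate (deviate a w) w' = deviate a w'.
Proof.
apply/colP => p; rewrite !deviate_coord.
move: (owner p) (tagnat.sig2 p) => j r.
have [ij|ij] := eqVneq i j; first by subst j; rewrite !dfwith_in.
by rewrite !dfwith_out// /deviate mxcolK dfwith_out.
Qed.

(** Each player brings its own coefficients, typically the gradient of its own cost, and only the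
    coordinates it owns survive in its summand. *)
Lemma sum_players (c : 'I_N -> 'I_(\sum_(i < N) n_ i) -> R) v :
  \sum_p c (owner p) p * v p 0 =
  \sum_i \sum_p c i p * deviate 0 (submxcol v i) p 0.
Proof.
rewrite exchange_big/=; apply: eq_bigr => p _.
rewrite [RHS](bigD1 (owner p))//= deviate0_submxcol [X in _ + X]big1 ?addr0// => i ip.
by rewrite deviate0_out ?mulr0// eq_sym.
Qed.

Lemma pseudogradient_coord (J : 'I_N -> profile -> R) a p :
  pseudogradient J a p 0 = grad (J (owner p)) a p 0.
Proof. by rewrite mxE -submxcol_coord. Qed.

Lemma game_hessian_coord (J : 'I_N -> profile -> R) a p q :
  game_hessian J a p q = hess (J (owner p)) a p q.
Proof. by rewrite mxE mxE !tagnat.sig2K. Qed.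

Lemma convex_function_along (f : profile -> R) i (w : 'cV[R]_(n_ i)) :
  (forall a, convex_function setT (fun y : 'cV[R]_(n_ i) => f (deviate a y))) ->
  convex_along f (deviate 0 w).
Proof.
move=> cf a t t0 t1.
have : f (deviate a (t *: (submxcol a i + w) + (1 - t) *: submxcol a i)) <=
    t * f (deviate a (submxcol a i + w)) + (1 - t) * f (deviate a (submxcol a i)).
  exact: (cf a (Itv01 t0 t1) _ _ (mem_set I) (mem_set I)).
rewrite (_ : t *: _ + _ = submxcol a i + t *: w).
  have := line_deviate a 1 w; rewrite !scale1r => <-.
  have := line_deviate a 0 w; rewrite !scale0r !addr0 => <-.
  by rewrite line_deviate [X in _ <= X -> _]addrC.
by apply/colP => r; rewrite !mxE; ring.
Qed.

Lemma along_convex_function (f : profile -> R) i a :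
  (forall w : 'cV[R]_(n_ i), convex_along f (deviate 0 w)) ->
  convex_function setT (fun y : 'cV[R]_(n_ i) => f (deviate a y)).
Proof.
move=> cf t x y _ _.
have t0 : 0 <= t%:num by [].
have t1 : t%:num <= 1 by [].
have := cf (x - y) (deviate a y) t%:num t0 t1.
rewrite line_deviate deviate_deviate submxcol_deviate.
have := deviateE (deviate a y) x; rewrite submxcol_deviate deviate_deviate => <-.
move=> h; suff : f (deviate a (t%:num *: x + (1 - t%:num) *: y)) <=
  t%:num * f (deviate a x) + (1 - t%:num) * f (deviate a y) by [].
rewrite [leRHS]addrC; apply: le_trans h.
rewrite le_eqVlt; apply/orP; left; apply/eqP; congr (f (deviate a _)).
by rewrite scalerBr scalerBl scale1r addrCA addrA.
Qed.

(** [F] is the value of the map at [x], not the map, so that the pseudogradient and its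
    linearization can be exchanged wherever their values agree. *)
Definition solves_VI (A : forall i, set 'cV[R]_(n_ i)) (F x : profile) := strategies A x /\
  forall x', strategies A x' -> 0 <= \sum_p F p 0 * (x' - x) p 0.

(** The equation forces the normal vector to be minus the linearization, and membership of that
    vector in the normal cone is the variational inequality. *)
Lemma josephy_newton_stepE (A : forall i, set 'cV[R]_(n_ i))
    (J : 'I_N -> profile -> R) y x :
  josephy_newton_step A J y x <->
  solves_VI A (pseudogradient J y + game_hessian J y *m (x - y)) x.
Proof.
have E (F b : profile) x' : F + b = 0 ->
    (b^T *m x') 0 0 = - \sum_p F p 0 * x' p 0.
  move=> Fb; have -> : b = - F by apply/eqP; rewrite -addr_eq0 addrC Fb.
  by rewrite mxE -sumrN; apply: eq_bigr => p _; rewrite !mxE mulNr.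
split=> [[b [Ax bx] Fb]|[Ax Fx]].
  by split=> // x' /bx; rewrite (E _ _ _ Fb) oppr_le0.
set F := (_ + _) in Fx *.
exists (- F); last exact: subrr.
by split=> // x' /Fx; rewrite (E F) ?subrr// oppr_le0.
Qed.

(** Moving a fraction t of the way to the own block of x' is feasible by convexity, so the right
    derivative of the own cost is nonnegative; summation over the players gives the inequality. *)
Lemma NE_solves_VI (A : forall i, set 'cV[R]_(n_ i))
    (J : 'I_N -> profile -> R) x :
  (forall i : 'I_N, convex_set (A i)) -> (forall i a, differentiable (J i) a) ->
  NESet A J x -> solves_VI A (pseudogradient J x) x.
Proof.
move=> cA dJ [Ax Jx]; split=> // x' Ax'.
under eq_bigr do rewrite pseudogradient_coord.
rewrite (sum_players (fun i p => grad (J i) x p 0)) sumr_ge0// => i _.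
have pJ : has_partials (J i) (fun p a => grad (J i) a p 0).
  by move=> a; split=> // p; rewrite mxE.
have := is_derive_line x (deviate 0 (submxcol (x' - x) i)) 0 pJ.
rewrite scale0r addr0 => d.
apply: (is_derive_right_ge d) => t t0 t1; rewrite mul0r subr_ge0 scale0r addr0.
rewrite line_deviate; apply: Jx.
have := cA i _ _ (Itv01 (ltW t0) t1) (mem_set (Ax' i)) (mem_set (Ax i)).
rewrite inE.
change (A i (t *: submxcol x' i + (1 - t) *: submxcol x i) ->
  A i (submxcol x i + t *: submxcol (x' - x) i)).
by congr (A i _); rewrite submxcolB scalerBr scalerBl scale1r addrCA addrA.
Qed.

(** Tested with a unilateral deviation, the inequality involves only the own gradient of the
    deviating player, and the gradient inequality for its convex cost gives optimality. *)
Lemma VI_solves_NE (A : forall i, set 'cV[R]_(n_ i))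
    (J : 'I_N -> profile -> R) x :
  convex_game A J -> (forall i a, differentiable (J i) a) ->
  solves_VI A (pseudogradient J x) x -> NESet A J x.
Proof.
move=> cJ dJ [Ax Fx]; split=> // i w Aw.
have pJ : has_partials (J i) (fun p a => grad (J i) a p 0).
  by move=> a; split=> // p; rewrite mxE.
have cf := @convex_function_along (J i) i (w - submxcol x i) (proj1 (cJ i)).
rewrite -subr_ge0 deviateE; apply: le_trans (convex_along_grad x pJ cf).
have := Fx (deviate x w).
have Ax' : strategies A (deviate x w).
  move=> j; rewrite /deviate mxcolK; have [ij|ij] := eqVneq i j.
    by subst j; rewrite dfwith_in.
  by rewrite dfwith_out.
move=> /(_ Ax'); under eq_bigr do rewrite pseudogradient_coord.
rewrite deviateE [x + _]addrC addrK.
congr (_ <= _); apply: eq_bigr => p _.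
by have [->//|pi] := eqVneq (owner p) i; rewrite deviate0_out// !mulr0.
Qed.

End blocks.

(** * The perturbed costs *)

Section perturbation.
Context {R : realType} {n : nat}.
Local Notation V := 'cV[R]_n.
Implicit Types (a v x y : V).

(** If both points lie in the ball of radius r + 1, its Lipschitz constant applies. Otherwise either
    both values vanish, or the points are at least 1 apart and a bound on [h] is enough. *)
Lemma llip_eq0_lipschitz (h : V -> R) (r : R) : llip h ->
  (forall a, r <= `|a| -> h a = 0) ->
  exists L : R, forall x y, `|h x - h y| <= L * `|x - y|.
Proof.
move=> lh h0; have [L L0 hL] := llip_ge0 lh (r + 1).
have [B B0 hB] := llip_bounded lh r.
have far x y : `|x| <= r -> r + 1 < `|y| -> `|h x| <= (L + B) * `|x - y|.
  move=> xr ry; rewrite (le_trans (hB _ xr))//.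
  have xy1 : 1 <= `|x - y|.
    by have := lerB_dist y x; rewrite distrC; lra.
  by rewrite -[leLHS]mulr1 ler_pM// lerDr.
exists (L + B) => x y.
have [xr|xr] := leP `|x| (r + 1); have [yr|yr] := leP `|y| (r + 1).
- by rewrite (le_trans (hL _ _ xr yr))// ler_wpM2r// lerDl.
- rewrite (h0 y) ?subr0; last lra.
  have [xr'|xr'] := leP `|x| r; first exact: far.
  by rewrite h0 ?normr0 ?mulr_ge0 ?addr_ge0//; lra.
- rewrite (h0 x) ?sub0r ?normrN; last lra.
  rewrite distrC; have [yr'|yr'] := leP `|y| r; first exact: far.
  by rewrite h0 ?normr0 ?mulr_ge0 ?addr_ge0//; lra.
- by rewrite !h0 ?subrr ?normr0 ?mulr_ge0 ?addr_ge0//; lra.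
Qed.

Lemma norm_mul_le (p q b d : R) : `|p| <= b -> `|q| <= d -> `|p * q| <= b * d.
Proof. by move=> pb qd; rewrite normrM ler_pM. Qed.

Lemma qformD (H H' : 'I_n -> 'I_n -> R) v :
  qform (fun p q => H p q + H' p q) v = qform H v + qform H' v.
Proof.
rewrite /qform -big_split/=; apply: eq_bigr => p _.
by rewrite -big_split/=; apply: eq_bigr => q _; ring.
Qed.

Lemma qformZ (k : R) (H : 'I_n -> 'I_n -> R) v :
  qform (fun p q => k * H p q) v = k * qform H v.
Proof.
rewrite /qform mulr_sumr; apply: eq_bigr => p _.
by rewrite mulr_sumr; apply: eq_bigr => q _; ring.
Qed.

Lemma qform_rank1 (u w : 'I_n -> R) v :
  qform (fun p q => u q * w p) v = (\sum_q u q * v q 0) * \sum_p w p * v p 0.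
Proof.
rewrite /qform mulr_sumr; apply: eq_bigr => p _.
by rewrite mulr_suml; apply: eq_bigr => q _; ring.
Qed.

Lemma qform_diag (k : R) v :
  qform (fun p q => k * (p == q)%:R) v = k * \sum_p v p 0 ^+ 2.
Proof.
rewrite qformZ; congr (_ * _); apply: eq_bigr => p _.
rewrite (bigD1 p)//= eqxx mul1r expr2 big1 ?addr0// => q qp.
by rewrite eq_sym (negbTE qp) !mul0r.
Qed.

Variables (f : V -> R) (f1 : 'I_n -> V -> R) (f2 : 'I_n -> 'I_n -> V -> R).
Hypothesis jf : jet2 f f1 f2.
Variable (L : R).
Hypothesis L0 : 0 <= L.
Hypothesis f2L : forall p q a b, `|f2 p q a - f2 p q b| <= L * `|a - b|.
Variables (c y : V) (rho : R).
Hypothesis rho0 : 0 < rho.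
Hypothesis yc : `|y - c| <= rho.

Let m : R := n%:R.
Let m0 : 0 <= m. Proof. exact: ler0n. Qed.

Definition sqdist a : R := (enorm (a - c) / rho) ^+ 2.

Lemma sqdistE : sqdist =
  quad 0 (fun=> 0) (fun p q => 2 / rho ^+ 2 * (p == q)%:R) c.
Proof.
apply/funext => a; rewrite /sqdist expr_div_n sqr_enorm /quad add0r.
rewrite [X in _ = X + _]big1 ?add0r => [|p _]; last by rewrite mul0r.
rewrite mulr_suml mulr_sumr; apply: eq_bigr => p _.
rewrite (bigD1 p)//= eqxx big1 ?addr0 => [|q qp].
  by rewrite !mxE mulr1; field; rewrite gt_eqF.
by rewrite eq_sym (negbTE qp) mulr0 mul0r.
Qed.

Let s1 p a : R := 2 / rho ^+ 2 * (a - c) p 0.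
Let s2 (p q : 'I_n) (_ : V) : R := 2 / rho ^+ 2 * (p == q)%:R.

Lemma jet2_sqdist : jet2 sqdist s1 s2.
Proof.
rewrite sqdistE; apply: jet2_ext (jet2_quad _ _ _ _) _ _ => //.
  by move=> p q; rewrite eq_sym.
move=> p a; rewrite add0r (bigD1 p)//= eqxx mulr1 big1 ?addr0 => [|q qp].
  by rewrite /s1 !mxE.
by rewrite eq_sym (negbTE qp) mulr0 mul0r.
Qed.

Definition taylor_gap a : R :=
  quad (f y) (f1^~ y) (fun p q => f2 p q y) y a - f a.

Let g1 p a : R := f1 p y + \sum_q f2 p q y * (a - y) q 0 - f1 p a.
Let g2 p q a : R := f2 p q y - f2 p q a.

Lemma jet2_gap : jet2 taylor_gap g1 g2.
Proof.
have jq : jet2 (quad (f y) (f1^~ y) (fun p q => f2 p q y) y) _ _ :=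
  jet2_quad _ _ _ (fun p q => schwarz y p q jf).
rewrite (_ : taylor_gap = fun a =>
    quad (f y) (f1^~ y) (fun p q => f2 p q y) y a + (-1) * f a); last first.
  by apply/funext => a; rewrite mulN1r.
apply: jet2_ext (jet2D jq (jet2M (jet2_cst (-1)) jf)) _ _ => [p a|p q a]; last first.
  by rewrite /g2; ring.
rewrite /g1 mul0r add0r mulN1r; congr (_ + _ - _).
by apply: eq_bigr => q _; rewrite !mxE.
Qed.

(** The gap vanishes to second order at [y] and its Hessian is Lipschitz, so the Taylor remainder
    bounds apply. *)
Lemma gap1_le p a : `|g1 p a| <= m * L * `|a - y| ^+ 2.
Proof.
apply: (taylor1_le a L0 jet2_gap) => [r q x|r]; first by rewrite distrC f2L.
rewrite /g1 subrr big1 ?addr0 ?subrr// => q _.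
by rewrite !mxE mulr0.
Qed.

Lemma gap_le a : `|taylor_gap a| <= m ^+ 2 * L * `|a - y| ^+ 3.
Proof.
apply: (taylor2_le a L0 jet2_gap) => [r q x|r|]; first by rewrite distrC f2L.
  rewrite /g1 subrr big1 ?addr0 ?subrr// => q _.
  by rewrite !mxE mulr0.
rewrite /taylor_gap /quad big1 => [|p _]; last by rewrite subrr mulr0.
rewrite big1 => [|p _]; first by rewrite mulr0 !addr0 subrr.
by rewrite big1// => q _; rewrite subrr mul0r mulr0.
Qed.

(* Chosen so that [bump * eta1 * tau] dominates the cutoff terms estimated as
   [T1], [T2], [T3] in [pert2_ge0]. *)
Definition bump : R := 200 ^+ 2 * m ^+ 4 * L * rho ^+ 3.

Definition pert a : R :=
  f a + (chi (sqdist a) * taylor_gap a + bump * eta (sqdist a)).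

Definition pert1 p a : R := f1 p a +
  (chi1 (sqdist a) * s1 p a * taylor_gap a + chi (sqdist a) * g1 p a
   + bump * (eta1 (sqdist a) * s1 p a)).

Definition pert2 p q a : R := f2 p q a +
  ((chi2 (sqdist a) * s1 q a * s1 p a + chi1 (sqdist a) * s2 p q a) * taylor_gap a
   + chi1 (sqdist a) * s1 p a * g1 q a
   + (chi1 (sqdist a) * s1 q a * g1 p a + chi (sqdist a) * g2 p q a)
   + bump * (eta2 (sqdist a) * s1 q a * s1 p a + eta1 (sqdist a) * s2 p q a)).

Lemma jet2_pert : jet2 pert pert1 pert2.
Proof.
have jc := jet2_comp (@is_derive_chi R) (@is_derive_chi1 R) llip_chi1 llip_chi2
  jet2_sqdist.
have je := jet2_comp (@is_derive_eta R) (@is_derive_eta1 R) llip_eta1 llip_eta2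
  jet2_sqdist.
apply: jet2_ext (jet2D jf (jet2D (jet2M jc jet2_gap)
   (jet2M (jet2_cst bump) je))) _ _ => [p a|p q a].
  by rewrite mul0r add0r.
by rewrite !mul0r !add0r.
Qed.

Lemma sqdist_ge3 a : 2 * rho <= `|a - c| -> 3 <= sqdist a.
Proof.
(* The factor 2 stands in for the square root of 3. *)
move=> h; rewrite (@le_trans _ _ (2 ^+ 2))//; first by lra.
rewrite lerXn2r ?nnegrE ?divr_ge0 ?enorm_ge0 ?(ltW rho0)//.
by rewrite ler_pdivlMr// (le_trans h)// norm_le_enorm.
Qed.

(** Beyond S = 3 the cutoff is gone and [eta] is linear, so [pert2] differs from the globally
    Lipschitz [f2] by the constant [bump * s2]. Subtracting both leaves a function of bounded
    support. *)
Lemma pert2_lipschitz p q :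
  exists M : R, forall a b, `|pert2 p q a - pert2 p q b| <= M * `|a - b|.
Proof.
have [_ _ lp] := jet2_pert; have [_ _ lf] := jf.
have [M hM] : exists M : R, forall a b,
    `|pert2 p q a + ((-1) * f2 p q a + - (bump * s2 p q a)) -
     (pert2 p q b + ((-1) * f2 p q b + - (bump * s2 p q b)))| <= M * `|a - b|.
  apply: (@llip_eq0_lipschitz _ (`|c| + 2 * rho)).
    exact: (llipD (lp p q) (llipD (llipM (llip_cst (-1)) (lf p q))
      (llip_cst (- (bump * (2 / rho ^+ 2 * (p == q)%:R)))))).
  move=> a ca; have /sqdist_ge3 s3 : 2 * rho <= `|a - c|.
    by have := lerB_dist a c; lra.
  have [cE0 cE1 cE2] := chi_outer s3; have [eE1 eE2] := eta_outer s3.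
  by rewrite /pert2 cE0 cE1 cE2 eE1 eE2; ring.
exists (M + L) => a b.
rewrite (_ : _ - _ = (pert2 p q a + ((-1) * f2 p q a + - (bump * s2 p q a)) -
     (pert2 p q b + ((-1) * f2 p q b + - (bump * s2 p q b))))
   + (f2 p q a - f2 p q b)); last by rewrite /s2; ring.
by rewrite (le_trans (ler_normD _ _))// mulrDl lerD.
Qed.

Lemma pert1_inner p a : enorm (a - c) < rho ->
  pert1 p a = f1 p y + \sum_q f2 p q y * (a - y) q 0.
Proof.
move=> ac; have s1' : sqdist a <= 1.
  rewrite expr_le1// ?divr_ge0 ?enorm_ge0 ?(ltW rho0)//.
  by rewrite ler_pdivrMr// mul1r ltW.
have [cE0 cE1 _] := chi_inner (le_trans s1' (ler1n _ 2)).
have [_ eE1] := eta_inner s1'.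
by rewrite /pert1 cE0 cE1 eE1 /g1; ring.
Qed.

Lemma norm_le_sqdist a : sqdist a <= 3 -> `|a - c| <= 2 * rho.
Proof.
move=> s3; rewrite leNgt; apply/negP => ac.
have ac' : 2 * rho < enorm (a - c) by rewrite (lt_le_trans ac)// norm_le_enorm.
have : 2 ^+ 2 < sqdist a.
  rewrite ltrXn2r// ?nnegrE ?divr_ge0 ?enorm_ge0 ?(ltW rho0)//.
  by rewrite ltr_pdivlMr.
lra.
Qed.

(** Here a is within 2 rho of [c], hence within 3 rho of [y], and the Taylor bounds become explicit
    powers of rho. *)
Lemma inner_bounds a : sqdist a <= 3 ->
  [/\ forall p, `|s1 p a| <= 4 / rho,
      `|taylor_gap a| <= m ^+ 2 * L * (3 * rho) ^+ 3 &
      forall p, `|g1 p a| <= m * L * (3 * rho) ^+ 2].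
Proof.
move=> s3; have ac := norm_le_sqdist s3.
have ay : `|a - y| <= 3 * rho.
  rewrite (le_trans (ler_distD c a y))// (_ : 3 * rho = 2 * rho + rho); last by ring.
  by rewrite lerD// distrC.
split=> [p||p].
- rewrite /s1 normrM ger0_norm ?divr_ge0 ?exprn_ge0 ?(ltW rho0)//.
  rewrite (_ : 4 / rho = 2 / rho ^+ 2 * (2 * rho)); last by field; rewrite gt_eqF.
  rewrite ler_wpM2l ?divr_ge0 ?exprn_ge0 ?(ltW rho0)//.
  by rewrite (le_trans (coord_le_norm _ _)).
- rewrite (le_trans (gap_le a))// ler_wpM2l ?mulr_ge0 ?exprn_ge0//.
  by rewrite lerXn2r ?nnegrE// (le_trans _ ay).
- rewrite (le_trans (gap1_le p a))// ler_wpM2l ?mulr_ge0//.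
  by rewrite lerXn2r ?nnegrE// (le_trans _ ay).
Qed.

Lemma pert1_near p a : `|f1 p a - pert1 p a| <=
  2 * 200 ^+ 2 * (m + m ^+ 2 + m ^+ 4) * L * rho * (rho + `|a - c|).
Proof.
have [_ _ c1 _] := chi_bounds (sqdist a); have [c0 c0' _ _] := chi_bounds (sqdist a).
have [e1 e1' _] := eta_bounds (sqdist a).
have bump0 : 0 <= bump by rewrite !mulr_ge0 ?exprn_ge0 ?(ltW rho0).
rewrite /pert1 opprD addrA subrr sub0r normrN.
(* Radial term: the factor rho^3 of [bump] against rho^-2 in [s1]. *)
have E : `|bump * (eta1 (sqdist a) * s1 p a)| <= 2 * 200 ^+ 2 * m ^+ 4 * L * rho * `|a - c|.
  rewrite normrM (ger0_norm bump0) normrM (ger0_norm e1) normrM.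
  rewrite (ger0_norm (_ : 0 <= 2 / rho ^+ 2)) ?divr_ge0 ?exprn_ge0 ?(ltW rho0)//.
  rewrite [leRHS](_ : _ = bump * (1 * (2 / rho ^+ 2 * `|a - c|))); last first.
    by rewrite /bump; field; rewrite gt_eqF.
  have r2 : 0 <= 2 / rho ^+ 2 by rewrite divr_ge0 ?exprn_ge0 ?(ltW rho0).
  have h : 2 / rho ^+ 2 * `|(a - c) p 0| <= 2 / rho ^+ 2 * `|a - c|.
    by rewrite ler_wpM2l// coord_le_norm.
  by apply: ler_wpM2l => //; apply: ler_pM => //; rewrite mulr_ge0.
(* Cutoff terms: rho^-1 times rho^3 and 1 times rho^2, both of order rho^2. *)
have E' : `|chi1 (sqdist a) * s1 p a * taylor_gap a + chi (sqdist a) * g1 p a| <=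
    (36 * 27 * m ^+ 2 + 9 * m) * L * rho ^+ 2.
  have [s3|/ltW s3] := leP (sqdist a) 3; last first.
    have [-> -> _] := chi_outer s3; rewrite !mul0r addr0 normr0.
    by rewrite !mulr_ge0 ?addr_ge0 ?mulr_ge0 ?exprn_ge0 ?(ltW rho0).
  have [b1 b2 b3] := inner_bounds s3.
  rewrite [leRHS](_ : _ = 9 * (4 / rho) * (m ^+ 2 * L * (3 * rho) ^+ 3)
     + 1 * (m * L * (3 * rho) ^+ 2)); last by field; rewrite gt_eqF.
  rewrite (le_trans (ler_normD _ _))//; apply: lerD.
    exact: norm_mul_le (norm_mul_le _ _) b2.
  by apply: norm_mul_le => //; rewrite ger0_norm.
rewrite (le_trans (ler_normD _ _))// (le_trans (lerD E' E))//.
have mono k d : 0 <= d -> 0 <= m ^+ k * (L * rho * d).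
  by move=> d0; rewrite mulr_ge0 ?exprn_ge0// !mulr_ge0 ?(ltW rho0).
have := mono 1 _ (ltW rho0); have := mono 2 _ (ltW rho0).
have := mono 4 _ (ltW rho0); have := mono 1 _ (normr_ge0 (a - c)).
have := mono 2 _ (normr_ge0 (a - c)).
lra.
Qed.

(** The form is a convex combination, with weight chi, of the Hessian forms at y and a, plus cutoff
    terms, plus a nonnegative radial term. Cutoff terms occur only for S between 2 and 3, where
    [eta1] is at least 1/2 and the radial term dominates them. *)
Lemma pert2_ge0 a v : 0 <= qform (fun p q => f2 p q y) v ->
  0 <= qform (fun p q => f2 p q a) v -> 0 <= qform (fun p q => pert2 p q a) v.
Proof.
move=> fy fa.
set S := sqdist a.
set sg := \sum_p s1 p a * v p 0; set gm := \sum_p g1 p a * v p 0.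
set tau := 2 / rho ^+ 2 * \sum_p v p 0 ^+ 2.
have tau_s2 : qform (fun p q => s2 p q a) v = tau by exact: qform_diag.
have -> : qform (fun p q => pert2 p q a) v =
    (1 - chi S) * qform (fun p q => f2 p q a) v
    + chi S * qform (fun p q => f2 p q y) v
    + (chi2 S * sg ^+ 2 * taylor_gap a + chi1 S * tau * taylor_gap a
       + 2 * (chi1 S * sg * gm))
    + bump * (eta2 S * sg ^+ 2 + eta1 S * tau).
  (* Everything but the Hessians of f and the diagonal [s2] is of rank one; the two mixed products
     of [s1] and [g1] are transposes and contribute equally. *)
  rewrite (_ : qform _ v = qform (fun p q =>
    (1 - chi S) * f2 p q a + (chi S * f2 p q y
    + (chi2 S * taylor_gap a * (s1 q a * s1 p a)
    + (chi1 S * taylor_gap a * s2 p q a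
    + (chi1 S * (g1 q a * s1 p a)
    + (chi1 S * (s1 q a * g1 p a)
    + (bump * eta2 S * (s1 q a * s1 p a)
    + bump * eta1 S * s2 p q a))))))) v).
    rewrite !qformD !qformZ !qform_rank1 -/sg -/gm.
    by rewrite qformZ in tau_s2; rewrite tau_s2; ring.
  congr (qform _ v); apply/funext => p; apply/funext => q.
  by rewrite /pert2 /g2 -/S; ring.
have [chi0 chi_1 b1 b2] := chi_bounds S.
have [e1 _ e2] := eta_bounds S.
have bump0 : 0 <= bump by rewrite !mulr_ge0 ?exprn_ge0 ?(ltW rho0).
have tau0 : 0 <= tau.
  rewrite mulr_ge0 ?divr_ge0 ?exprn_ge0 ?(ltW rho0)// sumr_ge0// => p _.
  exact: sqr_ge0.
have h1 : 0 <= (1 - chi S) * qform (fun p q => f2 p q a) v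
    + chi S * qform (fun p q => f2 p q y) v.
  by rewrite addr_ge0// mulr_ge0// subr_ge0.
rewrite -addrA addr_ge0//.
have [s2'|/ltW s2'] := leP S 2.
  have [_ -> ->] := chi_inner s2'; rewrite !mul0r mulr0 !addr0 add0r.
  by rewrite mulr_ge0// addr_ge0// mulr_ge0// sqr_ge0.
have [s3|/ltW s3] := leP S 3; last first.
  have [_ -> ->] := chi_outer s3; rewrite !mul0r mulr0 !addr0 add0r.
  by rewrite mulr_ge0// addr_ge0// mulr_ge0// sqr_ge0.
have [bs bg bg1] := inner_bounds s3.
set w := `|v|; have w0 : 0 <= w by exact: normr_ge0.
have sgw : `|sg| <= m * (4 / rho) * w by exact: norm_dot_le.
have gmw : `|gm| <= m * (m * L * (3 * rho) ^+ 2) * w by exact: norm_dot_le.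
have tau_ge : 2 / rho ^+ 2 * w ^+ 2 <= tau.
  rewrite ler_wpM2l ?divr_ge0 ?exprn_ge0 ?(ltW rho0)// -sqr_enorm.
  by rewrite lerXn2r ?nnegrE ?enorm_ge0// norm_le_enorm.
have vw p : v p 0 ^+ 2 <= w ^+ 2.
  by rewrite -(@real_normK _ (v p 0)) ?num_real// lerXn2r ?nnegrE// coord_le_norm.
have vsum : \sum_p v p 0 ^+ 2 <= m * w ^+ 2 := ler_sum_ord vw.
have tau_le : tau <= 2 / rho ^+ 2 * (m * w ^+ 2).
  by rewrite ler_wpM2l ?divr_ge0 ?exprn_ge0 ?(ltW rho0).
set P := L * rho * w ^+ 2.
have P0 : 0 <= P by rewrite !mulr_ge0 ?exprn_ge0 ?(ltW rho0).
have T1 : `|chi2 S * sg ^+ 2 * taylor_gap a| <= (72 * 16 * 27) * (m ^+ 4 * P).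
  rewrite [leRHS](_ : _ = 72 * (m * (4 / rho) * w) ^+ 2 * (m ^+ 2 * L * (3 * rho) ^+ 3)).
    apply: norm_mul_le bg; apply: norm_mul_le => //.
    by rewrite !expr2; exact: norm_mul_le.
  by rewrite /P; field; rewrite gt_eqF.
have T2 : `|chi1 S * tau * taylor_gap a| <= (18 * 27) * (m ^+ 3 * P).
  rewrite [leRHS](_ : _ = 9 * (2 / rho ^+ 2 * (m * w ^+ 2)) * (m ^+ 2 * L * (3 * rho) ^+ 3)).
    apply: norm_mul_le bg; apply: norm_mul_le => //.
    by rewrite ger0_norm.
  by rewrite /P; field; rewrite gt_eqF.
have T3 : `|chi1 S * sg * gm| <= (36 * 9) * (m ^+ 3 * P).
  rewrite [leRHS](_ : _ = 9 * (m * (4 / rho) * w) * (m * (m * L * (3 * rho) ^+ 2) * w)).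
    by apply: norm_mul_le => //; exact: norm_mul_le.
  by rewrite /P; field; rewrite gt_eqF.
have T4 : 200 ^+ 2 * (m ^+ 4 * P) <= bump * (eta2 S * sg ^+ 2 + eta1 S * tau).
  rewrite [leLHS](_ : _ = bump * (1 / 2 * (2 / rho ^+ 2 * w ^+ 2))); last first.
    by rewrite /bump /P; field; rewrite gt_eqF.
  rewrite ler_wpM2l//.
  have es : 0 <= eta2 S * sg ^+ 2 by rewrite mulr_ge0// sqr_ge0.
  apply: (@le_trans _ _ (eta1 S * tau)); last by rewrite lerDr.
  have half := eta1_ge_half s2'.
  have r2 : 0 <= 2 / rho ^+ 2 * w ^+ 2.
    by rewrite mulr_ge0 ?exprn_ge0// divr_ge0 ?exprn_ge0 ?(ltW rho0).
  by apply: ler_pM => //; lra.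
(* As m is a natural number, m^3 is at most m^4, including for m = 0. *)
have m34 : m ^+ 3 * P <= m ^+ 4 * P.
  rewrite ler_wpM2r// /m -!natrX ler_nat.
  by case: n => [|k] //; rewrite leq_pexp2l.
move: T1 T2 T3; rewrite !ler_norml => /andP[T1 _] /andP[T2 _] /andP[T3 _].
have P4 : 0 <= m ^+ 4 * P by rewrite mulr_ge0 ?exprn_ge0.
move: (m ^+ 4 * P) (m ^+ 3 * P) (chi2 S * _ * _) (chi1 S * tau * _)
  (chi1 S * sg * gm) (bump * _) T1 T2 T3 T4 m34 P4 => M4 M3 X1 X2 X3 X4 T1 T2 T3 T4 m34 P4.
(* The cutoff terms total at most 31104 + 486 + 2 * 324 = 32238 times m^4 P, below the 200^2 = 40000
   of the radial term. *)
lra.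
Qed.

End perturbation.

(** * Local convergence *)

Lemma lipschitzP {R : realType} {V : normedModType R} (h : V -> R) :
  lipschitz h <-> exists L : R, forall x y, `|h x - h y| <= L * `|x - y|.
Proof.
have PG : ProperFilter (globally ([set: V] `*` [set: V])).
  by apply: (@globally_properfilter _ _ (0, 0)).
split=> [/ex_dom_bound[L hL]|[L hL]].
  by exists L => x y; exact: (hL (x, y)).
by apply/ex_dom_bound; exists L => -[x y] _ /=; exact: hL.
Qed.

Lemma addcol_coord {R : realType} {k : nat} (u v : 'cV[R]_k) p :
  (u + v) p 0 = u p 0 + v p 0.
Proof. by rewrite mxE. Qed.

Lemma subcol_coord {R : realType} {k : nat} (u v : 'cV[R]_k) p :
  (u - v) p 0 = u p 0 - v p 0.
Proof. by rewrite !mxE. Qed.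

(** * The perturbed costs as a game near the original one *)

Section perturbed_game.
Context {R : realType} {N : nat} {n_ : 'I_N -> nat}.
Local Notation n := (\sum_(i < N) n_ i)%N.
Local Notation profile := 'cV[R]_n.
Local Notation owner := (@tagnat.sig1 N n_).
Implicit Types a x y : profile.

Variables (A : forall i, set 'cV[R]_(n_ i)) (J : 'I_N -> profile -> R).
Hypotheses (sJ : smooth_game J) (cJ : convex_game A J).

Let J1 i p a : R := grad (J i) a p 0.
Let J2 i p q a : R := hess (J i) a p q.

Lemma smooth_game_jet2 i : jet2 (J i) (J1 i) (J2 i).
Proof.
have [[[dJ _] C1J] lJ] := sJ i; split=> [a|p a|p q].
- by split=> // p; rewrite /J1 mxE.
- by have [dJ1 _] := C1J p; split=> // q; rewrite /J2 mxE.
- have /lipschitzP[L hL] := lJ p q; move=> r; exists L => x y _ _; exact: hL.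
Qed.

Lemma game_hessian_mul_coord a (v : profile) p : (game_hessian J a *m v) p 0 =
  \sum_q hess (J (owner p)) a p q * v q 0.
Proof. by rewrite mxE; apply: eq_bigr => q _; rewrite game_hessian_coord. Qed.

Lemma smooth_game_lipschitz : exists2 L : R, 0 <= L &
  forall i p q a b, `|J2 i p q a - J2 i p q b| <= L * `|a - b|.
Proof.
have /choice[L hL] : forall t : 'I_N * 'I_n * 'I_n, exists L : R, forall a b,
    `|J2 t.1.1 t.1.2 t.2 a - J2 t.1.1 t.1.2 t.2 b| <= L * `|a - b|.
  by move=> [[i p] q] /=; have [_ /(_ p q)/lipschitzP] := sJ i.
exists (\sum_t `|L t|) => [|i p q a b]; first by rewrite sumr_ge0.
rewrite (le_trans (hL (i, p, q) a b))// ler_wpM2r//.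
by rewrite (bigD1 (i, p, q))//= (le_trans (ler_norm _))// lerDl sumr_ge0.
Qed.

Lemma own_qform_ge0 i a (w : 'cV[R]_(n_ i)) :
  0 <= qform (fun p q => J2 i p q a) (deviate 0 w).
Proof.
apply: (convex_along_qform a (smooth_game_jet2 i)) => k.
by rewrite -deviate0Z; apply: convex_function_along; have [] := cJ i.
Qed.

Variable (L : R).
Hypothesis L0 : 0 <= L.
Hypothesis J2L : forall i p q a b, `|J2 i p q a - J2 i p q b| <= L * `|a - b|.

(** Up to sign, coordinate p of this error is the p-th partial derivative of the Taylor gap of the
    player who owns p. *)
Lemma linearization_le x y : enorm (pseudogradient J x -
    (pseudogradient J y + game_hessian J y *m (x - y))) <=
  n%:R ^+ 2 * L * `|x - y| ^+ 2.
Proof.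
rewrite (_ : _ * _ = n%:R * (n%:R * L * `|x - y| ^+ 2)); last by ring.
apply: enorm_le => [|p]; first by rewrite !mulr_ge0 ?exprn_ge0.
have := gap1_le (smooth_game_jet2 (owner p)) L0 (J2L (owner p)) y p x.
rewrite distrC => h; apply: le_trans h.
rewrite subcol_coord addcol_coord !pseudogradient_coord.
by rewrite game_hessian_mul_coord.
Qed.

Variables (c y : profile) (rho : R).
Hypothesis rho0 : 0 < rho.
Hypothesis yc : `|y - c| <= rho.

Definition pert_game i := pert (J i) (J1 i) (J2 i) L c y rho.

Lemma jet2_pert_game i : jet2 (pert_game i) (pert1 (J i) (J1 i) (J2 i) L c y rho)
  (pert2 (J i) (J1 i) (J2 i) L c y rho).
Proof. exact: jet2_pert (smooth_game_jet2 i) _ _ _ _ rho0. Qed.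

Lemma smooth_pert_game : smooth_game pert_game.
Proof.
move=> i; split; first exact: jet2_C2 (jet2_pert_game i).
move=> p q; rewrite (_ : (fun a => _) = pert2 (J i) (J1 i) (J2 i) L c y rho p q).
  have [M hM] := pert2_lipschitz (smooth_game_jet2 i) (J2L i) c y rho0 p q.
  by apply/lipschitzP; exists M => a b; exact: hM.
by apply/funext => a; exact: jet2_hess (jet2_pert_game i).
Qed.

Lemma convex_pert_game : convex_game A pert_game.
Proof.
move=> i; split; last by have [] := cJ i.
move=> a; apply: along_convex_function => w.
apply: (qform_ge0_convex (jet2_pert_game i)) => b.
by apply: (pert2_ge0 (smooth_game_jet2 i) L0 (J2L i) rho0 yc);
  exact: own_qform_ge0.
Qed.

Lemma pert_game_differentiable i a : differentiable (pert_game i) a.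
Proof. by have [pf _ _] := jet2_pert_game i; have [] := pf a. Qed.

Lemma pert_game_inner a : enorm (a - c) < rho ->
  pseudogradient pert_game a = pseudogradient J y + game_hessian J y *m (a - y).
Proof.
move=> ac; apply/colP => p.
rewrite pseudogradient_coord (jet2_grad _ _ (jet2_pert_game (owner p))).
rewrite pert1_inner// addcol_coord pseudogradient_coord.
by rewrite game_hessian_mul_coord.
Qed.

(** On a fixed ball this is O(rho), which puts the game in the neighborhood required by stability.
    Keeping the dependence on |a - c| is what later places the equilibrium inside the ball of radius
    rho. *)
Lemma pert_game_near a : enorm (pseudogradient J a - pseudogradient pert_game a) <=
  n%:R * (2 * 200 ^+ 2 * (n%:R + n%:R ^+ 2 + n%:R ^+ 4) * L) * rho
    * (rho + `|a - c|).
Proof.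
rewrite -2!mulrA; apply: enorm_le => [|p].
  by rewrite !mulr_ge0 ?addr_ge0 ?exprn_ge0 ?(ltW rho0).
rewrite mulrA subcol_coord !pseudogradient_coord (jet2_grad _ _ (jet2_pert_game (owner p))).
exact: (pert1_near (smooth_game_jet2 (owner p)) L0 (J2L (owner p)) rho0 yc).
Qed.

(** Inside the ball of radius rho the pseudogradient at x is the linearization at y, so both sides
    are the same variational inequality. *)
Lemma pert_game_NE x : enorm (x - c) < rho ->
  NESet A pert_game x <-> josephy_newton_step A J y x.
Proof.
move=> xc; rewrite josephy_newton_stepE -pert_game_inner//; split.
  apply: NE_solves_VI; [by move=> i; have [_ []] := cJ i|].
  exact: pert_game_differentiable.
apply: VI_solves_NE; [exact: convex_pert_game|exact: pert_game_differentiable].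
Qed.

End perturbed_game.

(** * Existence and error estimate for one Newton step *)

Section local_convergence.
Context {R : realType} {N : nat} {n_ : 'I_N -> nat}.
Local Notation n := (\sum_(i < N) n_ i)%N.
Local Notation profile := 'cV[R]_n.
Implicit Types a x y : profile.

Variables (A : forall i, set 'cV[R]_(n_ i)) (J : 'I_N -> profile -> R).
Hypotheses (sJ : smooth_game J) (cJ : convex_game A J).
Variable astar : profile.

(** The quadratic bound gives the rate; the halving of the error gives convergence in the first
    place. *)
Lemma josephy_newton_local : stable_NE A J astar ->
  exists rho C : R, [/\ 0 < rho, 0 <= C & forall y, enorm (y - astar) < rho ->
    (exists2 x, josephy_newton_step A J y x & enorm (x - astar) < rho) /\
    forall x, josephy_newton_step A J y x -> enorm (x - astar) < rho ->
      enorm (x - astar) <= C * enorm (y - astar) ^+ 2 /\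
      enorm (x - astar) <= enorm (y - astar) / 2].
Proof.
move=> [NEa [Om0 /nbhs_ballP[r0 /= r00 rOm0] NEOm0] stab].
(* Halving the radius puts the closed ball inside the isolating neighborhood. *)
pose r := r0 / 2; have r_gt0 : 0 < r by rewrite divr_gt0.
have clE x : closure (ball astar r) x <-> `|astar - x| <= r.
  by rewrite -[closure _]/(closed_ball astar r) closed_ballE.
have rr0 : r < r0 by rewrite /r ltr_pdivrMr// ltr_pMr// ltr1n.
have NEcl : NESet A J `&` closure (ball astar r) = [set astar].
  apply/seteqP; split=> [x [NEx /clE xr]|x ->].
    rewrite -NEOm0; split=> //; apply: rOm0.
    by rewrite -ball_normE /ball_/= (le_lt_trans xr).
  by split=> //; apply/clE; rewrite subrr normr0 ltW.
have oB : open (ball astar r) by exact: ball_open.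
have aB : ball astar r astar by exact: ballxx.
have [c [eps [c0 eps0 stabOm]]] := stab _ oB aB NEcl.
have [L L0 JL] := smooth_game_lipschitz sJ.
pose M : R := n%:R ^+ 2 * L.
pose D : R := n%:R * (2 * 200 ^+ 2 * (n%:R + n%:R ^+ 2 + n%:R ^+ 4) * L).
have M0 : 0 <= M by rewrite mulr_ge0 ?exprn_ge0.
have D0 : 0 <= D by rewrite !mulr_ge0 ?addr_ge0 ?exprn_ge0.
have lin x y : enorm (pseudogradient J x -
      (pseudogradient J y + game_hessian J y *m (x - y))) <= M * `|x - y| ^+ 2.
  exact: linearization_le.
have nearJ y rho (rho0 : 0 < rho) (yc : `|y - astar| <= rho) x :
    enorm (pseudogradient J x - pseudogradient (pert_game J L astar y rho) x) <=
    D * rho * (rho + `|x - astar|).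
  exact: pert_game_near.
clearbody M D.
(* Each summand encodes one upper bound on rho = 1/T: rho <= 1, rho <= r, D(1 + r) rho <= eps/2, 4cD
   rho <= 1 and 8cM rho <= 1. *)
pose T := 1 + r^-1 + D * (1 + r) * (2 / eps) + 4 * (c * D) + 8 * (c * M).
have t1 : 0 < r^-1 by rewrite invr_gt0.
have t2 : 0 <= D * (1 + r) * (2 / eps).
  by rewrite !mulr_ge0 ?addr_ge0 ?invr_ge0 ?(ltW r_gt0) ?(ltW eps0).
have t3 : 0 <= c * D by rewrite mulr_ge0 ?(ltW c0).
have t4 : 0 <= c * M by rewrite mulr_ge0 ?(ltW c0).
have T0 : 0 < T by rewrite /T; lra.
pose rho := T^-1; have rho0 : 0 < rho by rewrite invr_gt0.
have rhoT z : z <= T -> z * rho <= 1.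
  by move=> zT; rewrite ler_pdivrMr// mul1r.
have rho1 : rho <= 1 by rewrite -[rho]mul1r rhoT// /T; lra.
have rho_r : rho <= r.
  by rewrite -[leRHS]mulr1 mulrC -ler_pdivrMr// mulrC rhoT// /T; lra.
have rho_eps : D * (1 + r) * rho <= eps / 2.
  have : D * (1 + r) * (2 / eps) * rho <= 1 by rewrite rhoT// /T; lra.
  rewrite (_ : _ * rho = D * (1 + r) * rho / (eps / 2)); last by field; rewrite gt_eqF.
  by rewrite ler_pdivrMr ?divr_gt0// mul1r.
have rho_D : 4 * (c * D) * rho <= 1 by rewrite rhoT// /T; lra.
have rho_M : 8 * (c * M) * rho <= 1 by rewrite rhoT// /T; lra.
exists rho, (4 * (c * M)); split=> [//||y ya]; first by rewrite !mulr_ge0 ?(ltW c0).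
have ya' : `|y - astar| <= rho by rewrite (le_trans (norm_le_enorm _)) ?ltW.
pose J' := pert_game J L astar y rho.
have inner x : enorm (x - astar) < rho -> closure (ball astar r) x.
  move=> xa; apply/clE; rewrite distrC (le_trans (norm_le_enorm _))//.
  exact: le_trans (ltW xa) rho_r.
have near := nearJ _ _ rho0 ya'.
have nbhdJ' : game_nbhd A J eps (strategies A `&` closure (ball astar r)) J'.
  split; [exact: smooth_pert_game|exact: convex_pert_game|].
  (* The margin eps/2 is needed because a supremum of values below eps may equal eps. *)
  apply: (@le_lt_trans _ _ (eps / 2)%:E); last first.
    by rewrite lte_fin ltr_pdivrMr// ltr_pMr// ltr1n.
  apply: ge_ereal_sup => _ [x [_ /clE xr] <-]; rewrite lee_fin.
  rewrite (le_trans (near x))// (le_trans _ rho_eps)//.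
  rewrite [leRHS]mulrAC ler_wpM2l ?mulr_ge0 ?(ltW rho0)//.
  by rewrite lerD// distrC.
have [[x0 [NEx0 x0cl]] bound] := stabOm _ nbhdJ'.
split.
  have x0rho : enorm (x0 - astar) < rho.
    have := bound _ (conj NEx0 x0cl).
    move=> /le_trans/(_ (ler_wpM2l (ltW c0) (near x0))) => h.
    have h' : c * (D * rho * (rho + `|x0 - astar|)) <=
        c * D * rho * (rho + enorm (x0 - astar)).
      rewrite [leRHS](_ : _ = c * (D * rho * (rho + enorm (x0 - astar)))); last by ring.
      rewrite ler_wpM2l ?(ltW c0)// ler_wpM2l ?mulr_ge0 ?(ltW rho0)//.
      by rewrite lerD2l norm_le_enorm.
    have e0 := enorm_ge0 (x0 - astar).
    (* From e <= k(rho + e) with k <= 1/4 follows e <= rho/3. *)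
    have := le_trans h h'; set e := enorm _ in e0 *; set k := c * D * rho.
    have k4 : 4 * k <= 1 by rewrite /k mulrA.
    have k0 : 0 <= k by rewrite mulr_ge0 ?(ltW rho0).
    nra.
  by exists x0 => //; apply/(pert_game_NE sJ cJ L0 JL rho0 ya' x0rho).
move=> x /(pert_game_NE sJ cJ L0 JL rho0 ya') xstep xrho.
have := bound x (conj (xstep xrho) (inner _ xrho)).
(* The error bound of stability now involves F(x) minus the linearization at y, which is quadratic
   in x - y. *)
rewrite pert_game_inner// => h.
have := le_trans h (ler_wpM2l (ltW c0) (lin x y)).
have ex0 := enorm_ge0 (x - astar); have ey0 := enorm_ge0 (y - astar).
have xy : `|x - y| <= enorm (x - astar) + enorm (y - astar).
  rewrite (le_trans (ler_distD astar x y))// lerD ?norm_le_enorm//.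
  by rewrite distrC norm_le_enorm.
have xy2 : `|x - y| ^+ 2 <= (enorm (x - astar) + enorm (y - astar)) ^+ 2.
  by rewrite lerXn2r ?nnegrE ?addr_ge0.
move=> /le_trans/(_ (ler_wpM2l (ltW c0) (ler_wpM2l M0 xy2))).
rewrite mulrA.
set ex := enorm (x - astar) in ex0 xrho *.
set ey := enorm (y - astar) in ey0 ya *; set k := c * M in t4 rho_M *.
move=> main.
(* Here (ex + ey)^2 <= 2 ex^2 + 2 ey^2 and ex < rho. As 2k rho <= 1/4, the term in ex is absorbed on
   the left. *)
have sq : k * (ex + ey) ^+ 2 <= 2 * k * rho * ex + 2 * k * ey ^+ 2.
  have : 0 <= k * (ex - ey) ^+ 2 by rewrite mulr_ge0 ?sqr_ge0.
  have : k * ex * ex <= k * ex * rho by rewrite ler_wpM2l ?mulr_ge0// ltW.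
  nra.
have q1 : ex <= 4 * k * ey ^+ 2.
  have : 8 * k * rho * ex <= 1 * ex by rewrite ler_wpM2r.
  lra.
split=> //; apply: le_trans q1 _.
(* With ey < rho and 8k rho <= 1, the bound 4k ey^2 is at most ey/2. *)
have : k * ey * ey <= k * ey * rho by rewrite ler_wpM2l ?mulr_ge0// ltW.
have : 8 * k * rho * ey <= 1 * ey by rewrite ler_wpM2r.
lra.
Qed.

End local_convergence.

Lemma enorm_geometric_cvg {R : realType} {n : nat} (u : nat -> 'cV[R]_n) a :
  (forall k, enorm (u k.+1 - a) <= enorm (u k - a) / 2) -> u @ \oo --> a.
Proof.
move=> uS; have ub k : enorm (u k - a) <= enorm (u 0%N - a) * 2^-1 ^+ k.
  elim: k => [|k IH]; first by rewrite mulr1.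
  by rewrite (le_trans (uS k))// exprSr mulrA ler_wpM2r.
have g0 : enorm (u 0%N - a) * 2^-1 ^+ k @[k --> \oo] --> (0 : R).
  rewrite -[0](mulr0 (enorm (u 0%N - a))); apply: cvgMr.
  by apply: cvg_expr; rewrite ger0_norm// invf_lt1// ltr1n.
apply/cvgrPdist_le => e e0; near=> k.
have ke : `|0 - enorm (u 0%N - a) * 2^-1 ^+ k| <= e.
  by near: k; exact: (cvgr_dist_le _ _ g0 _ e0).
rewrite distrC (le_trans (norm_le_enorm _))// (le_trans (ub k))//.
by move: ke; rewrite sub0r normrN; apply: le_trans; exact: ler_norm.
Unshelve. all: by end_near. Qed.

Theorem theorem4 (R : realType) (N : nat) (n_ : 'I_N -> nat)
    (A : forall i : 'I_N, set 'cV[R]_(n_ i))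
    (J : 'I_N -> 'cV[R]_(\sum_(i < N) n_ i) -> R)
    (astar : 'cV[R]_(\sum_(i < N) n_ i)) :
  smooth_game J -> convex_game A J -> stable_NE A J astar ->
  exists2 delta : R, 0 < delta &
    forall a0, (strategies A `&` eball astar delta) a0 ->
      (exists u, josephy_newton_seq A J a0 u /\
                 forall k, eball astar delta (u k)) /\
      (forall u, josephy_newton_seq A J a0 u ->
                 (forall k, eball astar delta (u k)) ->
                 Qquadratic_cvg u astar).
Proof.
move=> sJ cJ stab.
have [rho [C [rho0 C0 local]]] := josephy_newton_local sJ cJ stab.
exists rho => // a0 [_ a0rho]; split; last first.
  move=> u [_ ustep] urho.
  have u_le k := proj2 (local _ (urho k)) _ (ustep k) (urho k.+1).
  split; first by apply: enorm_geometric_cvg => k; exact: (proj2 (u_le k)).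
  by exists C; near=> k; exact: (proj1 (u_le k)).
(* Subproblems may have several solutions, so one inside the ball is chosen for each y. Outside the
   ball the value is the default 0, which the iteration never uses. *)
have /choice[next nextP] : forall y, exists x, enorm (y - astar) < rho ->
    josephy_newton_step A J y x /\ enorm (x - astar) < rho.
  move=> y; have [/local[[x yx xrho] _]|_] := boolP (enorm (y - astar) < rho).
    by exists x.
  by exists 0.
have nextrho k : enorm (iter k next a0 - astar) < rho.
  by elim: k => // k IH; exact: (proj2 (nextP _ IH)).
exists (fun k => iter k next a0); split=> //; split=> // k.
exact: (proj1 (nextP _ (nextrho k))).
Unshelve. all: by end_near. Qed.
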